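(* Let $(T,A)$ be a measurable cocycle on $\Delta\times\mathbb{R}^p$. For $\mu$-almost every $x\in\Delta$ the following holds: if $G\subset\mathbb{R}^p$ is any affine subspace parallel to a linear subspace $G_0\subset\mathbb{R}^p$ transverse to the central stable space $E^{cs}(x)$ (i.e. $G_0\cap E^{cs}(x)=\{0\}$), then the Hausdorff dimension of $G\cap W^s(x)$ is equal to $0$.
   Context: A cocycle is a pair $(T,A)$, $T:\Delta\to\Delta$, $A:\Delta\to\mathrm{GL}(p,\mathbb{R})$, viewed as $(x,w)\mapsto(T(x),A(x)w)$, with $A_n(x)=A(T^{n-1}(x))\cdots A(x)$. It is a measurable cocycle if $(\Delta,\mu)$ is a probability space, $\mu$ is $T$-invariant and ergodic, $A$ is measurable and $\int_\Delta\ln\|A(x)\|\,d\mu(x)<\infty$. Central stable space: $E^{cs}(x)=\{w:\limsup_n\|A_n(x)w\|^{1/n}\le1\}$. Weak-stable space: $W^s(x)=\{w\in\mathbb{R}^p:\|A_n(x)w\|_{\mathbb{R}^p/\mathbb{Z}^p}\to0\}$, where $\|\cdot\|_{\mathbb{R}^p/\mathbb{Z}^p}$ is the Euclidean distance to $\mathbb{Z}^p$. *)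

(* Defs.v *)
From HB Require Import structures.
From mathcomp Require Import all_boot all_order all_algebra.
From mathcomp Require Import all_classical all_reals all_analysis.
Set Implicit Arguments. Unset Strict Implicit. Unset Printing Implicit Defensive.
Import Order.TTheory GRing.Theory Num.Theory.
Local Open Scope classical_set_scope.
Local Open Scope ring_scope.

Section CocycleDefs.
Variable R : realType.

Definition enorm (p : nat) (v : 'cV[R]_p) : R :=
  Num.sqrt (\sum_(i < p) (v i 0) ^+ 2).

Definition opnorm (p : nat) (M : 'M[R]_p) : R :=
  sup [set enorm (M *m w) | w in [set w : 'cV[R]_p | enorm w <= 1]].

Fixpoint cocycle_iter (Delta : Type) (p : nat) (T : Delta -> Delta)
    (A : Delta -> 'M[R]_p) (n : nat) (x : Delta) : 'M[R]_p :=
  match n with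
  | 0 => 1%:M
  | n'.+1 => A (iter n' T x) *m cocycle_iter T A n' x
  end.

Definition int_vec (p : nat) (z : 'cV[int]_p) : 'cV[R]_p :=
  map_mx (fun k : int => k%:~R) z.

Definition torus_norm (p : nat) (v : 'cV[R]_p) : R :=
  inf [set enorm (v - int_vec z) | z in [set: 'cV[int]_p]].

Definition central_stable (Delta : Type) (p : nat) (T : Delta -> Delta)
    (A : Delta -> 'M[R]_p) (x : Delta) : set 'cV[R]_p :=
  [set w | (limn_esup (fun n : nat =>
       ((enorm (cocycle_iter T A n x *m w)) `^ (n%:R^-1))%:E) <= 1%:E)%E].

Definition weak_stable (Delta : Type) (p : nat) (T : Delta -> Delta)
    (A : Delta -> 'M[R]_p) (x : Delta) : set 'cV[R]_p :=
  [set w | (fun n : nat => torus_norm (cocycle_iter T A n x *m w)) @ \oo --> 0].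

Definition ediam (p : nat) (U : set 'cV[R]_p) : \bar R :=
  ereal_sup [set (enorm (u - v))%:E | u in U & v in U].

Definition diam_pow (p : nat) (s : R) (U : set 'cV[R]_p) : \bar R :=
  if U == set0 then 0%E else ((fine (ediam U)) `^ s)%:E.

Definition hausdorff_content (p : nat) (s delta : R) (S : set 'cV[R]_p) : \bar R :=
  ereal_inf [set (\sum_(0 <= i <oo) diam_pow s (U i))%E
            | U in [set U : nat -> set 'cV[R]_p |
                      S `<=` \bigcup_i U i /\
                      forall i, (ediam (U i) <= delta%:E)%E]].

(* s-dimensional Hausdorff outer measure H^s(S) = lim_{delta -> 0} H^s_delta(S)
   (= sup over delta > 0, since H^s_delta is nonincreasing in delta). *)
Definition hausdorff_measure (p : nat) (s : R) (S : set 'cV[R]_p) : \bar R :=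
  ereal_sup [set hausdorff_content s delta S | delta in [set d : R | 0 < d]].

Definition hausdorff_dim (p : nat) (S : set 'cV[R]_p) : \bar R :=
  ereal_inf [set s%:E | s in [set s : R | 0 <= s /\ hausdorff_measure s S = 0%E]].

End CocycleDefs.

Definition measure_preserving (d : measure_display) (R : realType)
    (Delta : measurableType d) (mu : probability Delta R) (T : Delta -> Delta) :=
  measurable_fun setT T /\
  forall B : set Delta, measurable B -> mu (T @^-1` B) = mu B.

Definition ergodic (d : measure_display) (R : realType)
    (Delta : measurableType d) (mu : probability Delta R) (T : Delta -> Delta) :=
  forall B : set Delta, measurable B -> T @^-1` B = B ->
    mu B = 0%E \/ mu B = 1%E.

Definition measurable_cocycle (d : measure_display) (R : realType)
    (Delta : measurableType d) (mu : probability Delta R) (p : nat)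
    (T : Delta -> Delta) (A : Delta -> 'M[R]_p) :=
  [/\ measure_preserving mu T, ergodic mu T,
      (forall x, A x \in unitmx),
      (forall i j, measurable_fun setT (fun x => A x i j)) &
      (\int[mu]_x (maxe (ln (opnorm (A x)))%:E 0%E) < +oo)%E].

(* Main.v *)
Require Import Defs.
From HB Require Import structures.
From mathcomp Require Import all_boot all_order all_algebra.
From mathcomp Require Import all_classical all_reals all_analysis.
From mathcomp Require Import measurable_realfun.
From mathcomp Require Import ring lra zify.
Import Order.TTheory GRing.Theory Num.Theory.
Import numFieldNormedType.Exports.
Local Open Scope classical_set_scope.
Local Open Scope ring_scope.

(** Write A_n for the cocycle over the orbit of x, and V_q(A_n) for the largest
    factor by which A_n stretches q-dimensional volumes.  Let L_q be the
    exponential growth rate of max(1, V_q(A_n)) and let q be the first index with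
    L_(q+1) <= L_q, so that q counts the positive Lyapunov exponents.

    By the argument of Karlsson and Margulis, almost every orbit has infinitely
    many record times N: V_q(A_N) exceeds V_q of the product from n to N by a
    factor e^((L_q - eps) n), for all n <= N up to constants.  At a record time,
    choose a q-frame X that nearly realises V_q(A_N).  A vector f with A_N f
    orthogonal to A_N X satisfies
      |A_n f| <= 2 |f| V_q(A_(n -> N)) V_(q+1)(A_n) / V_q(A_N),
    hence does not grow at any n <= N, while A_N expands the span of X uniformly,
    at rate L_q - L_(q-1).  If some unit vectors of G_0 failed to be expanded at
    the record times, their components f would accumulate at a nonzero vector of
    G_0 that lies in the central stable space.  So for infinitely many N the
    matrix A_N expands all of G_0 by e^(chi N), without any integrability of the
    inverse cocycle.

    A point w of the weak-stable space is eventually followed by integer vectors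
    z_n within delta of A_n w.  Given z_n, the number of candidates for z_(n+1)
    is at most max(1, 4 delta (1 + |A|))^p, whose logarithm has a small integral
    when delta is small; by the ergodic theorem there are only e^(eta N)
    itineraries of length N.  Each of them confines w, inside G, to a set of
    diameter e^(-chi N), and eta is arbitrarily small. *)

(** * Gram determinants and volume growth *)

Section Gram.
Set Implicit Arguments.
Unset Strict Implicit.
Variable R : realType.

Definition sqn p (v : 'cV[R]_p) : R := \sum_(i < p) (v i 0) ^+ 2.
Definition gram p q (X : 'M[R]_(p, q)) : R := \det (X^T *m X).

Lemma sqnE p (v : 'cV[R]_p) : sqn v = (v^T *m v) 0 0.
Proof. by rewrite mxE; apply: eq_bigr => i _; rewrite mxE expr2. Qed.

Lemma sqn_ge0 p (v : 'cV[R]_p) : 0 <= sqn v.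
Proof. by apply: sumr_ge0 => i _; exact: sqr_ge0. Qed.

Lemma sqn_eq0 p (v : 'cV[R]_p) : sqn v = 0 -> v = 0.
Proof.
move=> /eqP; rewrite /sqn psumr_eq0 => [|i _]; last exact: sqr_ge0.
move=> /allP h; apply/matrixP => i j; rewrite ord1 mxE; apply/eqP.
by rewrite -sqrf_eq0; apply: (implyP (h i _)) => //; rewrite mem_index_enum.
Qed.

Lemma sqn0 p : sqn (0 : 'cV[R]_p) = 0.
Proof. by rewrite /sqn big1 // => i _; rewrite mxE expr0n. Qed.

Lemma sqn_gt0 p (v : 'cV[R]_p) : v != 0 -> 0 < sqn v.
Proof.
move=> v0; rewrite lt_neqAle sqn_ge0 andbT; apply: contra v0 => /eqP h.
by apply/eqP/sqn_eq0; rewrite -h.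
Qed.

Lemma sqn_orth p (u v : 'cV[R]_p) : u^T *m v = 0 ->
  sqn (u + v) = sqn u + sqn v.
Proof.
move=> uv; have vu : v^T *m u = 0 by apply: trmx_inj; rewrite trmx_mul trmxK uv trmx0.
have E : (u + v)^T = u^T + v^T by rewrite linearD.
by rewrite !sqnE E mulmxDl !mulmxDr uv vu addr0 add0r mxE.
Qed.

Lemma sqnZ p a (v : 'cV[R]_p) : sqn (a *: v) = a ^+ 2 * sqn v.
Proof. by rewrite /sqn mulr_sumr; apply: eq_bigr => i _; rewrite mxE exprMn. Qed.

Lemma gramMr p q (X : 'M[R]_(p, q)) (C : 'M[R]_q) :
  gram (X *m C) = gram X * \det C ^+ 2.
Proof. by rewrite /gram trmx_mul -mulmxA (mulmxA X^T) !det_mulmx det_tr; ring. Qed.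

Lemma gram_col p (v : 'cV[R]_p) : gram v = sqn v.
Proof. by rewrite /gram det_mx11 sqnE. Qed.

Lemma gram_orth p q (u : 'cV[R]_p) (Y : 'M[R]_(p, q)) : u^T *m Y = 0 ->
  gram (row_mx u Y) = sqn u * gram Y.
Proof.
move=> uY; rewrite /gram tr_row_mx mul_col_row uY det_lblock -(gram_col u).
by [].
Qed.

Lemma gram_shearr p q (u : 'cV[R]_p) (Y : 'M[R]_(p, q)) (s : 'rV[R]_q) :
  gram (row_mx u (Y + u *m s)) = gram (row_mx u Y).
Proof.
have -> : row_mx u (Y + u *m s) = row_mx u Y *m block_mx 1%:M s 0 1%:M.
  by rewrite mul_row_block !mulmx1 mulmx0 addr0 addrC.
by rewrite gramMr det_ublock !det1 mulr1 expr1n mulr1.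
Qed.

Lemma gram_shearl p q (u : 'cV[R]_p) (Y : 'M[R]_(p, q)) (c : 'cV[R]_q) :
  gram (row_mx (u + Y *m c) Y) = gram (row_mx u Y).
Proof.
have -> : row_mx (u + Y *m c) Y = row_mx u Y *m block_mx 1%:M 0 c 1%:M.
  by rewrite mul_row_block !mulmx1 mulmx0 add0r.
by rewrite gramMr det_lblock !det1 mulr1 expr1n mulr1.
Qed.

Lemma orth_residual p q (u : 'cV[R]_p) (Y : 'M[R]_(p, q)) : u != 0 ->
  exists s : 'rV[R]_q, u^T *m (Y + u *m s) = 0.
Proof.
move=> u0; exists (- (sqn u)^-1 *: (u^T *m Y)).
have usu : u^T *m u = (sqn u)%:M.
  by apply/matrixP => i j; rewrite !ord1 -sqnE mxE eqxx.
rewrite mulmxDr mulmxA usu mul_scalar_mx scalerA mulrN divff ?scaleN1r ?subrr//.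
by rewrite gt_eqF// sqn_gt0.
Qed.

(** Induction on the number of columns: shearing by the first column makes the others orthogonal to
    it, and the determinant then factors. *)
Lemma gram_ge0 p q (X : 'M[R]_(p, q)) : 0 <= gram X.
Proof.
elim: q X => [|q IH] X; first by rewrite /gram det_mx00.
rewrite -[X](@hsubmxK _ p 1 q); set u := lsubmx _; set Y := rsubmx _.
have [u0|u0] := eqVneq u 0.
  by rewrite u0 gram_orth ?sqn0 ?mul0r// trmx0 mul0mx.
have [s hs] := orth_residual Y u0.
by rewrite -(gram_shearr _ _ s) gram_orth// mulr_ge0// sqn_ge0.
Qed.

Lemma gram_eq0P p q (X : 'M[R]_(p, q)) :
  gram X = 0 <-> exists2 c : 'cV[R]_q, c != 0 & X *m c = 0.
Proof.
split => [/eqP/det0P[v v0 hv]|[c c0 Xc]].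
  exists v^T; first by rewrite -(inj_eq (@trmx_inj _ _ _)) trmxK trmx0.
  apply: sqn_eq0; rewrite sqnE trmx_mul trmxK mulmxA -(mulmxA v) hv mul0mx.
  by rewrite mxE.
apply/eqP/det0P; exists c^T.
  by rewrite -(inj_eq (@trmx_inj _ _ _)) trmxK trmx0.
by rewrite mulmxA -trmx_mul Xc trmx0 mul0mx.
Qed.

Lemma gram_mull_eq0 p p' q (M : 'M[R]_(p', p)) (X : 'M[R]_(p, q)) :
  gram X = 0 -> gram (M *m X) = 0.
Proof.
by move=> /gram_eq0P[c c0 Xc]; apply/gram_eq0P; exists c; rewrite // -mulmxA Xc mulmx0.
Qed.

Lemma gram_row_eq0 p q (u : 'cV[R]_p) (Y : 'M[R]_(p, q)) :
  gram Y = 0 -> gram (row_mx u Y) = 0.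
Proof.
move=> /gram_eq0P[c c0 Yc]; apply/gram_eq0P; exists (col_mx 0 c).
  by apply: contra c0 => /eqP; rewrite -col_mx0 => /eq_col_mx[_ ->].
by rewrite mul_row_col mulmx0 add0r.
Qed.

Lemma normal_eq p q (u : 'cV[R]_p) (Y : 'M[R]_(p, q)) : gram Y != 0 ->
  exists c : 'cV[R]_q, Y^T *m (u - Y *m c) = 0.
Proof.
move=> gY; have U : Y^T *m Y \in unitmx by rewrite unitmxE unitfE.
exists (invmx (Y^T *m Y) *m (Y^T *m u)).
by rewrite mulmxBr !mulmxA mulmxV// mul1mx subrr.
Qed.

Lemma tr_orth p q (u : 'cV[R]_p) (Y : 'M[R]_(p, q)) : Y^T *m u = 0 -> u^T *m Y = 0.
Proof. by move=> h; apply: trmx_inj; rewrite trmx_mul trmxK h trmx0. Qed.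

(** Fischer's inequality. Subtracting from [u] its orthogonal projection onto the columns of [Y]
    leaves the left side unchanged and can only shorten [u]. *)
Lemma gram_fischer p q (u : 'cV[R]_p) (Y : 'M[R]_(p, q)) :
  gram (row_mx u Y) <= sqn u * gram Y.
Proof.
have [g0|g0] := eqVneq (gram Y) 0; first by rewrite gram_row_eq0// g0 mulr0.
have [c hc] := normal_eq u g0.
rewrite -(gram_shearl _ _ (- c)) mulmxN gram_orth ?tr_orth//.
rewrite ler_wpM2r ?gram_ge0//.
rewrite -{2}(subrK (Y *m c) u) [leRHS]sqn_orth ?lerDl ?sqn_ge0//.
by rewrite mulmxA tr_orth// mul0mx.
Qed.

(** With [b] adjoined as a column, the shear by [b *m s] becomes invisible and the determinant is
    [sqn b * gram Y]. Fischer's inequality bounds it by [sqn b] times the right side. *)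
Lemma gram_rank1 p q (b : 'cV[R]_p) (Y : 'M[R]_(p, q)) (s : 'rV[R]_q) :
  b^T *m Y = 0 -> gram Y <= gram (Y + b *m s).
Proof.
move=> bY; have [->|b0] := eqVneq b 0; first by rewrite mul0mx addr0.
have := gram_fischer b (Y + b *m s).
by rewrite gram_shearr gram_orth// ler_pM2l// sqn_gt0.
Qed.

(** Once the first column is replaced by its residual against the others, the determinant of [X]
    factors exactly, while that of the image is bounded by Fischer's inequality. *)
Lemma gram_mull_le p p' q (M : 'M[R]_(p', p)) (K : R) (X : 'M[R]_(p, q)) :
  0 <= K -> (forall u, sqn (M *m u) <= K * sqn u) ->
  gram (M *m X) <= K ^+ q * gram X.
Proof.
move=> K0 hK; elim: q X => [|q IH] X; first by rewrite /gram !det_mx00 mul1r.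
rewrite -[X](@hsubmxK _ p 1 q); set u := lsubmx _; set Y := rsubmx _.
rewrite (mul_mx_row M u Y).
have [g0|g0] := eqVneq (gram Y) 0.
  by rewrite !gram_row_eq0 ?mulr0// gram_mull_eq0.
have [c hc] := normal_eq u g0.
rewrite -(gram_shearl (M *m u) _ (- c)) -(gram_shearl u _ (- c)).
rewrite [X in _ <= _ * X]gram_orth ?mulmxN ?tr_orth//.
rewrite -mulmxA -mulmxBr (le_trans (gram_fischer _ _))//.
by rewrite exprS mulrACA ler_pM ?sqn_ge0 ?gram_ge0.
Qed.

Definition absum p (M : 'M[R]_p) : R := \sum_i \sum_j `|M i j|.

Lemma sum_sqr_le n (a : 'I_n -> R) : (forall i, 0 <= a i) ->
  \sum_i a i ^+ 2 <= (\sum_i a i) ^+ 2.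
Proof.
move=> a0; rewrite expr2 mulr_suml ler_sum// => i _.
rewrite expr2 ler_wpM2l// (bigD1 i)//= lerDl sumr_ge0//.
Qed.

Lemma absum_ge0 p (M : 'M[R]_p) : 0 <= absum M.
Proof. by rewrite sumr_ge0// => i _; rewrite sumr_ge0. Qed.

Lemma sqr_entry_le p (u : 'cV[R]_p) i : u i 0 ^+ 2 <= sqn u.
Proof. by rewrite /sqn (bigD1 i)//= lerDl sumr_ge0// => j _; exact: sqr_ge0. Qed.

Lemma sqn_mul_le p (M : 'M[R]_p) (u : 'cV[R]_p) :
  sqn (M *m u) <= absum M ^+ 2 * sqn u.
Proof.
set r := Num.sqrt (sqn u).
have ru j : `|u j 0| <= r by rewrite -sqrtr_sqr ler_wsqrtr// sqr_entry_le.
have r2 : sqn u = r ^+ 2 by rewrite sqr_sqrtr// sqn_ge0.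
have h i : ((M *m u) i 0) ^+ 2 <= (\sum_j `|M i j|) ^+ 2 * sqn u.
  rewrite r2 -exprMn -(@real_normK _ ((M *m u) i 0)) ?num_real//.
  rewrite ler_pXn2r ?nnegrE ?normr_ge0//; last first.
    by rewrite mulr_ge0 ?sqrtr_ge0 ?sumr_ge0.
  rewrite mxE mulr_suml (le_trans (ler_norm_sum _ _ _))// ler_sum// => j _.
  by rewrite normrM ler_wpM2l.
apply: (le_trans (ler_sum _ (fun i _ => h i))).
rewrite -mulr_suml ler_wpM2r ?sqn_ge0// sum_sqr_le// => i.
by rewrite sumr_ge0.
Qed.

(** The square of the norm of the q-th exterior power of [M]. Degenerate frames enter with the value
    0, since a quotient by 0 is 0. *)
Definition vol2 p q (M : 'M[R]_p) : R :=
  sup [set gram (M *m X) / gram X | X in [set: 'M[R]_(p, q)]].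

Lemma vol2_has_sup p q (M : 'M[R]_p) :
  has_sup [set gram (M *m X) / gram X | X in [set: 'M[R]_(p, q)]].
Proof.
split; first by exists (gram (M *m (0 : 'M[R]_(p, q))) / gram (0 : 'M[R]_(p, q))), 0.
exists ((absum M ^+ 2) ^+ q) => _ [X _ <-].
have [->|g0] := eqVneq (gram X) 0; first by rewrite invr0 mulr0 !exprn_ge0 ?absum_ge0.
rewrite ler_pdivrMr ?lt_neqAle ?gram_ge0 ?andbT 1?eq_sym//.
by apply: gram_mull_le; [rewrite exprn_ge0 ?absum_ge0|exact: sqn_mul_le].
Qed.

Lemma gram_le_vol2 p q (M : 'M[R]_p) (X : 'M[R]_(p, q)) :
  gram (M *m X) <= vol2 q M * gram X.
Proof.
have [g0|g0] := eqVneq (gram X) 0; first by rewrite g0 mulr0 gram_mull_eq0.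
rewrite -ler_pdivrMr ?lt_neqAle ?gram_ge0 ?andbT 1?eq_sym//.
by apply: (ub_le_sup (vol2_has_sup q M).2); exists X.
Qed.

Lemma vol2_le p q (M : 'M[R]_p) K : 0 <= K ->
  (forall X : 'M[R]_(p, q), gram (M *m X) <= K * gram X) -> vol2 q M <= K.
Proof.
move=> K0 hK; apply: ge_sup; first exact: (vol2_has_sup q M).1.
move=> _ [X _ <-]; have [->|g0] := eqVneq (gram X) 0; first by rewrite invr0 mulr0.
by rewrite ler_pdivrMr ?lt_neqAle ?gram_ge0 ?andbT 1?eq_sym.
Qed.

Lemma vol2_ge0 p q (M : 'M[R]_p) : 0 <= vol2 q M.
Proof.
apply: (@le_trans _ _ (gram (M *m (0 : 'M[R]_(p, q))) / gram (0 : 'M[R]_(p, q)))).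
  by rewrite divr_ge0 ?gram_ge0.
by apply: (ub_le_sup (vol2_has_sup q M).2); exists 0.
Qed.

Lemma vol2M p q (M N : 'M[R]_p) : vol2 q (M *m N) <= vol2 q M * vol2 q N.
Proof.
apply: vol2_le => [|X]; first by rewrite mulr_ge0 ?vol2_ge0.
rewrite -mulmxA (le_trans (gram_le_vol2 _ _))// -mulrA ler_wpM2l ?vol2_ge0//.
exact: gram_le_vol2.
Qed.

Lemma vol2_le_absum p q (M : 'M[R]_p) : vol2 q M <= (absum M ^+ 2) ^+ q.
Proof.
apply: vol2_le => [|X]; first by rewrite !exprn_ge0 ?absum_ge0.
by apply: gram_mull_le; [rewrite exprn_ge0 ?absum_ge0|exact: sqn_mul_le].
Qed.

Lemma vol2_id p q : vol2 q (1%:M : 'M[R]_p) <= 1.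
Proof. by apply: vol2_le => // X; rewrite mul1mx mul1r. Qed.

Lemma vol2_dim0 p (M : 'M[R]_p) : vol2 0 M <= 1.
Proof. by apply: vol2_le => // X; rewrite /gram !det_mx00 mulr1. Qed.

Lemma vol2_dim_gt p (M : 'M[R]_p) : vol2 p.+1 M = 0.
Proof.
apply/eqP; rewrite eq_le vol2_ge0 andbT; apply: vol2_le => // X.
rewrite mul0r le_eqVlt gram_mull_eq0 ?eqxx//; apply/gram_eq0P.
have [v v0 vX] : exists2 v : 'rV[R]_p.+1, v != 0 & v *m X^T = 0.
  have /rowV0Pn[v /sub_kermxP vX v0] : kermx X^T != 0.
    rewrite -mxrank_eq0 mxrank_ker -lt0n subn_gt0.
    exact: leq_ltn_trans (rank_leq_col _) _.
  by exists v.
exists v^T; first by rewrite -(inj_eq (@trmx_inj _ _ _)) trmxK trmx0.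
by apply: trmx_inj; rewrite trmx_mul trmxK vX trmx0.
Qed.

Lemma sqn_le_vol2 p (M : 'M[R]_p) (u : 'cV[R]_p) : sqn (M *m u) <= vol2 1 M * sqn u.
Proof. by rewrite -!gram_col; exact: gram_le_vol2. Qed.

(** The factor 2 is the price for not showing that the supremum is attained. *)
Lemma vol2_near_max p q (M : 'M[R]_p) : 0 < vol2 q M ->
  exists X : 'M[R]_(p, q), [/\ gram X != 0, gram (M *m X) != 0 &
    vol2 q M * gram X <= 2 * gram (M *m X)].
Proof.
move=> V0.
have V20 : 0 < vol2 q M / 2 by rewrite divr_gt0.
have [_ [X _ <-]] := sup_adherent V20 (vol2_has_sup q M).
rewrite -/(vol2 q M) => h; exists X.
have V2 : 0 < gram (M *m X) / gram X by apply: le_lt_trans h; lra.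
have gX : gram X != 0 by apply: contraTneq V2 => ->; rewrite invr0 mulr0 ltxx.
split => //; first by apply: contraTneq V2 => ->; rewrite mul0r ltxx.
have gX0 : 0 < gram X by rewrite lt_neqAle gram_ge0 andbT eq_sym.
have : vol2 q M / 2 < gram (M *m X) / gram X by apply: le_lt_trans h; lra.
by rewrite ltr_pdivlMr// => h'; lra.
Qed.

(* The vector [M *m u] is split off from the frame [M *m X] by projecting the
   frame orthogonally to it; since [P *m M *m u] is orthogonal to
   [P *m M *m X], this projection can only increase the volume of the image
   of the frame under [P]. *)
Lemma slow_estimate p q (P M : 'M[R]_p) (X : 'M[R]_(p, q)) (u : 'cV[R]_p) :
  (P *m M *m X)^T *m (P *m M *m u) = 0 ->
  sqn (M *m u) * gram (P *m M *m X) <= vol2 q P * vol2 (1 + q) M * (sqn u * gram X).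
Proof.
move=> orth; set t := M *m u; set Z := M *m X.
have [t0|t0] := eqVneq t 0.
  by rewrite t0 sqn0 mul0r !mulr_ge0 ?vol2_ge0 ?sqn_ge0 ?gram_ge0.
have [s hs] := orth_residual Z t0; set Z' := Z + t *m s in hs.
have h1 : gram (P *m M *m X) <= vol2 q P * gram Z'.
  apply: le_trans (gram_le_vol2 _ _).
  have -> : P *m Z' = P *m M *m X + (P *m M *m u) *m s.
    by rewrite /Z' mulmxDr /Z /t !mulmxA.
  by apply: gram_rank1; apply: tr_orth.
have h2 : sqn t * gram Z' <= vol2 (1 + q) M * (sqn u * gram X).
  rewrite -gram_orth// gram_shearr -mul_mx_row (le_trans (gram_le_vol2 _ _))//.
  by rewrite ler_wpM2l ?vol2_ge0// gram_fischer.
rewrite (le_trans (ler_wpM2l (sqn_ge0 _) h1))// mulrCA -mulrA.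
by rewrite ler_wpM2l ?vol2_ge0.
Qed.

(** A frame with the span of [X] may be chosen with first column [X *m c]. Fischer's inequality
    separates the image of this column from the images of the other [q] columns, whose volume
    [vol2 q B] controls. *)
Lemma fast_estimate p q (B : 'M[R]_p) (X : 'M[R]_(p, 1 + q)) (c : 'cV[R]_(1 + q)) :
  gram (B *m X) * sqn (X *m c) <= sqn (B *m (X *m c)) * vol2 q B * gram X.
Proof.
set u := X *m c; have [u0|u0] := eqVneq u 0.
  by rewrite u0 sqn0 mulr0 !mulr_ge0 ?sqn_ge0 ?vol2_ge0 ?gram_ge0.
have c0 : c != 0 by apply: contraNneq u0 => c0; rewrite /u c0 mulmx0.
(* The rank factorization of [c^T] completes [c] to an invertible matrix with first column [c]. *)
have [C UC cC] : exists2 C : 'M[R]_(1 + q), C \in unitmx & lsubmx C = c.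
  have rc : \rank c^T = 1%N by rewrite mxrank_tr; apply/eqP; rewrite eqn_leq rank_leq_col lt0n mxrank_eq0.
  have E := mulmx_ebase c^T; rewrite rc in E.
  pose a := col_ebase c^T.
  exists ((block_mx a 0 0 1%:M *m row_ebase c^T)^T).
    rewrite unitmx_tr unitmx_mul row_ebase_unit andbT unitmxE det_ublock det1 mulr1.
    by rewrite -unitmxE col_ebase_unit.
  rewrite -[RHS]trmxK -{2}E; apply: trmx_inj; rewrite trmxK trmx_lsub trmxK.
  rewrite -[row_ebase c^T]vsubmxK mul_block_col mul0mx addr0 col_mxKu.
  rewrite vsubmxK -mulmxA; congr (_ *m _).
  have -> : pid_mx 1 = row_mx 1%:M 0 :> 'M[R]_(1, 1 + q).
    by rewrite -[1%N in LHS]/1%N pid_mx_row.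
  by rewrite -[row_ebase c^T in RHS]vsubmxK mul_row_col mul1mx mul0mx addr0.
pose Y := X *m rsubmx C.
have XC : X *m C = row_mx u Y by rewrite -[C]hsubmxK mul_mx_row cC.
have dC : 0 < \det C ^+ 2 by rewrite exprn_even_gt0//= -unitfE -unitmxE.
(* Multiplying both sides by the squared determinant of [C] replaces [X] by [X *m C]. *)
rewrite -(ler_pM2r dC) -[leRHS]mulrA -gramMr mulrAC -gramMr -mulmxA XC.
have [s hs] := orth_residual Y u0.
rewrite mul_mx_row -(gram_shearr u Y s) -(gram_shearr (B *m u) _ s).
rewrite -mulmxA -mulmxDr (gram_orth hs).
have h := gram_fischer (B *m u) (B *m (Y + u *m s)).
have h' := gram_le_vol2 B (Y + u *m s).
have S0 := sqn_ge0 (B *m u); have S1 := sqn_ge0 u.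
apply: (le_trans (ler_wpM2r S1 h)).
rewrite [leRHS](_ : _ = sqn (B *m u) * (vol2 q B * gram (Y + u *m s)) * sqn u); last by ring.
by rewrite ler_wpM2r// ler_wpM2l.
Qed.

End Gram.

(** * Subadditive processes and record times *)

Section Ergodic.
Set Implicit Arguments.
Unset Strict Implicit.
Context (d : measure_display) (R : realType) (Delta : measurableType d).
Variable mu : probability Delta R.

Section MeasurePreserving.
Variable T : Delta -> Delta.
Hypothesis Tmp : measure_preserving mu T.

Lemma measure_preserving_iter n : measure_preserving mu (iter n T).
Proof.
have [mT pT] := Tmp.
elim: n => [|n [mn pn]]; first by split=> //; exact: measurable_id.
split; first exact: (measurableT_comp mT mn).
move=> B mB; rewrite [X in mu X](_ : _ = iter n T @^-1` (T @^-1` B))//.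
by rewrite pn ?pT// -[X in measurable X]setTI; exact: mT.
Qed.

Lemma measurable_iter n : measurable_fun setT (iter n T).
Proof. exact: (measure_preserving_iter n).1. Qed.

Lemma integral_measure_preserving (f : Delta -> \bar R) :
  measurable_fun setT f -> (forall x, (0 <= f x)%E) ->
  (\int[mu]_x f (T x) = \int[mu]_x f x)%E.
Proof.
move=> mf f0; have [mT pT] := Tmp.
pose Tm : {mfun Delta >-> Delta} := HB.pack T (isMeasurableFun.Build _ _ _ _ T mT).
rewrite -[RHS](@eq_measure_integral _ _ _ _ mu (pushforward mu Tm)).
  by rewrite ge0_integral_pushforward.
by move=> A mA _; exact: pT.
Qed.

End MeasurePreserving.

Lemma integral_iter_measure_preserving T n (f : Delta -> \bar R) :
  measure_preserving mu T ->
  measurable_fun setT f -> (forall x, (0 <= f x)%E) ->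
  (\int[mu]_x f (iter n T x) = \int[mu]_x f x)%E.
Proof.
move=> Tmp mf f0; apply: (integral_measure_preserving _ mf f0).
exact: measure_preserving_iter.
Qed.

(* Horizons m at which the growth up to every intermediate time j has rate at
   least c; they exist infinitely often by an argument of Karlsson and Margulis. *)
Definition record_set (T : Delta -> Delta) (a : nat -> Delta -> R) c m : set Delta :=
  [set x | forall j, (0 < j <= m)%N -> a (m - j)%N (iter j T x) + c * j%:R <= a m x].

Definition limsup_set (G : nat -> set Delta) : set Delta :=
  [set x | forall M, exists2 m, (M <= m)%N & G m x].

Lemma measurable_limsup_set G : (forall m, measurable (G m)) -> measurable (limsup_set G).
Proof.
move=> mG; rewrite (_ : limsup_set G = \bigcap_M \bigcup_(m in [set m | (M <= m)%N]) G m).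
  apply: bigcapT_measurable => M; apply: bigcup_measurable => m _; exact: mG.
apply/seteqP; split => x /=.
  by move=> h M _; have [m Mm Gm] := h M; exists m.
by move=> h M; have [m Mm Gm] := h M I; exists m.
Qed.

Lemma measurable_record_set T a c m : measure_preserving mu T ->
  (forall n, measurable_fun setT (a n)) -> measurable (record_set T a c m).
Proof.
move=> Tmp ma.
rewrite (_ : record_set _ _ _ _ = \bigcap_(j in [set j | (0 < j <= m)%N])
   [set x | a (m - j)%N (iter j T x) + c * j%:R <= a m x]).
  apply: bigcap_measurableType.
  move=> j _; rewrite -[X in measurable X]setTI.
  have h : measurable_fun setT
     (fun x => a (m - j)%N (iter j T x) + c * j%:R <= a m x).
    apply: measurable_fun_ler => //; apply: measurable_funD => //.
    exact: (measurableT_comp (ma _) (measurable_iter Tmp _)).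
  exact: (h measurableT [set true]).
by apply/seteqP; split => x /= h j; exact: h.
Qed.

Lemma sum_tail_le (F : nat -> R) j m : (forall k, 0 <= F k) ->
  \sum_(k < m) F (j + k)%N <= \sum_(k < j + m) F k.
Proof. by move=> F0; rewrite big_split_ord/= lerDr sumr_ge0. Qed.

(** Walk along the orbit with a budget of [c] per step. At a record point one step is taken and the
    excess [phi] is paid; elsewhere a jump stays within the budget. So [phi] is paid only at times
    [k] that are records for the remaining horizon [n - k]. *)
Lemma record_pointwise T (a : nat -> Delta -> R) (c : R) (phi : Delta -> R) :
  (forall x, a 0%N x <= 0) ->
  (forall n m x, a (n + m)%N x <= a n x + a m (iter n T x)) ->
  (forall x, 0 <= phi x) ->
  (forall x, a 1%N x <= phi x + c) ->
  forall n x, a n x <= c * n%:R +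
    \sum_(k < n) phi (iter k T x) * \1_(record_set T a c (n - k)) (iter k T x).
Proof.
move=> a0 asub phi0 aphi; elim/ltn_ind => -[_ x|n IH x].
  by rewrite big_ord0 mulr0 addr0.
have [xG|xG] := pselect (record_set T a c n.+1 x).
  rewrite big_ord_recl subn0 /= indicE mem_set// mulr1.
  have := asub 1%N n x; rewrite add1n => /le_trans; apply.
  have := IH n (ltnSn n) (T x).
  rewrite (eq_bigr (fun i : 'I_n => phi (iter (bump 0 i) T x) *
     \1_(record_set T a c (n.+1 - bump 0 i)) (iter (bump 0 i) T x))); last first.
    by move=> i _; rewrite /bump/= add1n subSS -iterSr iterS.
  have := aphi x; rewrite -natr1 /=; set S := \sum_(_ < _) _; lra.
(* Failure of the record condition yields a jump of length [j] costing less than [c * j]; induction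
   applies at the landing point, with horizon [n.+1 - j]. *)
have [j /andP[j0 jn] aj] : exists2 j, (0 < j <= n.+1)%N &
    a n.+1 x < a (n.+1 - j)%N (iter j T x) + c * j%:R.
  move: xG => /existsNP[j /not_implyP[jn /negP]]; rewrite -ltNge => h.
  by exists j.
have := IH (n.+1 - j)%N; rewrite ltn_subrL j0 => /(_ isT (iter j T x)) h.
apply: (le_trans (ltW aj)); apply: (le_trans (lerD h (lexx _))).
rewrite [leLHS]addrAC -mulrDr -natrD subnK// lerD2l.
pose F k := phi (iter k T x) * \1_(record_set T a c (n.+1 - k)) (iter k T x).
have F0 k : 0 <= F k by rewrite mulr_ge0.
have := sum_tail_le j (n.+1 - j) F0; rewrite subnKC// => /(le_trans _); apply.
by rewrite ler_sum// => i _; rewrite /F -iterD addnC subnDA.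
Qed.

Lemma record_integral T (u v phi : Delta -> R) (G : nat -> set Delta) n :
  measure_preserving mu T ->
  measurable_fun setT u -> measurable_fun setT v -> measurable_fun setT phi ->
  (forall x, 0 <= u x) -> (forall x, 0 <= v x) -> (forall x, 0 <= phi x) ->
  (forall m, measurable (G m)) ->
  (forall x, u x <= v x +
     \sum_(k < n) phi (iter k T x) * \1_(G (n - k)%N) (iter k T x)) ->
  (\int[mu]_x (u x)%:E <= \int[mu]_x (v x)%:E +
     \sum_(k < n) \int[mu]_x (phi x * \1_(G (n - k)%N) x)%:E)%E.
Proof.
move=> Tmp mu_ mv mphi u0 v0 phi0 mG h.
have mpG m : measurable_fun setT (fun x => phi x * \1_(G m) x).
  by apply: measurable_funM => //; exact: measurable_indic.
have mpGk m k : measurable_fun setT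
    (fun x => phi (iter k T x) * \1_(G m) (iter k T x)).
  exact: (measurableT_comp (mpG m) (measurable_iter Tmp k)).
have pG0 m x : 0 <= phi x * \1_(G m) x by rewrite mulr_ge0.
have -> : (\sum_(k < n) \int[mu]_x (phi x * \1_(G (n - k)%N) x)%:E =
   \int[mu]_x (\sum_(k < n) phi (iter k T x) * \1_(G (n - k)%N) (iter k T x))%:E)%E.
  under [RHS]eq_integral do rewrite -sumEFin.
  rewrite ge0_integral_sum//; last by move=> *; rewrite lee_fin.
    apply: eq_bigr => k _.
    rewrite -(integral_iter_measure_preserving k Tmp) => //.
      exact/measurable_EFinP.
    by move=> x; rewrite lee_fin.
  by move=> k; exact/measurable_EFinP.
rewrite -ge0_integralD//; first last.
- exact/measurable_EFinP/measurable_sum.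
- by move=> x _; rewrite lee_fin sumr_ge0.
- exact/measurable_EFinP.
- by move=> x _; rewrite lee_fin.
apply: ge0_le_integral => //.
- by move=> x _; rewrite lee_fin.
- exact/measurable_EFinP.
- apply: emeasurable_funD; first exact/measurable_EFinP.
  exact/measurable_EFinP/measurable_sum.
by move=> x _; rewrite -EFinD lee_fin.
Qed.


(** A Cesaro argument: all but finitely many terms are at most [eps], and the remaining ones are
    collected in [C]. *)
Lemma sum_vanishing_le (e : nat -> R) : (forall m, 0 <= e m) ->
  e @ \oo --> 0 -> forall eps, 0 < eps ->
  exists C, forall n, \sum_(k < n) e (n - k)%N <= C + eps * n%:R.
Proof.
move=> e0 ecvg eps eps0.
have [M _ hM] : \forall m \near \oo, e m <= eps.
  by move/cvgrPdist_le : ecvg => /(_ _ eps0); apply: filterS => m; rewrite sub0r normrN ger0_norm.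
exists (\sum_(k < M) e k) => n.
rewrite (reindex_inj rev_ord_inj)/= (eq_bigr (fun k : 'I_n => e k.+1)); last first.
  by move=> k _; rewrite subKn.
elim: n => [|n IH]; first by rewrite big_ord0 mulr0 addr0 sumr_ge0.
rewrite big_ord_recr/=; have [Mn|nM] := leqP M n.+1.
  by rewrite -natr1 mulrDr mulr1 addrA lerD// hM.
have := @sum_tail_le e 1 n.+1 e0; rewrite big_ord_recr/= add1n => h.
apply: (le_trans (_ : _ <= \sum_(k < n.+2) e k)); first by under eq_bigr do rewrite -add1n.
rewrite -[leLHS]addr0 lerD ?mulr_ge0 ?(ltW eps0)//.
by rewrite -(subnKC nM) big_split_ord/= lerDl sumr_ge0.
Qed.

(** Off the limsup set the indicators vanish for all large [m], and [phi] dominates. *)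
Lemma integral_indic_vanishing (phi : Delta -> R) (G : nat -> set Delta) :
  measurable_fun setT phi -> (forall x, 0 <= phi x) ->
  (\int[mu]_x (phi x)%:E < +oo)%E ->
  (forall m, measurable (G m)) -> mu (limsup_set G) = 0%E ->
  (fun m => \int[mu]_x (phi x * \1_(G m) x)%:E)%E @ \oo --> 0%E.
Proof.
move=> mphi phi0 iphi mG L0.
have mpG m : measurable_fun setT (fun x => phi x * \1_(G m) x).
  by apply: measurable_funM => //; exact: measurable_indic.
have [] := @dominated_convergence _ _ _ mu _ measurableT
  (fun m x => (phi x * \1_(G m) x)%:E) (cst 0%E) (fun x => (phi x)%:E).
- by move=> m; exact/measurable_EFinP.
- exact: measurable_cst.
- exists (limsup_set G); split => //; first exact: measurable_limsup_set.
  move=> x /= /not_implyP[_]; apply: contra_notP => /existsNP[M hM].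
  apply: (@cvg_near_cst).
  exists M => // m /= Mm; rewrite indicE memNset ?mulr0//.
  by move=> Gm; apply: hM; exists m.
- apply/integrableP; split; first exact/measurable_EFinP.
  by under eq_integral do rewrite gee0_abs ?lee_fin//.
- apply: aeW => x m _; rewrite gee0_abs ?lee_fin ?mulr_ge0//.
  by rewrite indicE ler_piMr//; case: (_ \in _).
- move=> _ _; rewrite integral_cst// mul0e; exact.
Qed.

Lemma sum_integral_indic_le (phi : Delta -> R) (G : nat -> set Delta) :
  measurable_fun setT phi -> (forall x, 0 <= phi x) ->
  (\int[mu]_x (phi x)%:E < +oo)%E ->
  (forall m, measurable (G m)) -> mu (limsup_set G) = 0%E ->
  forall eps, 0 < eps -> exists C, forall n,
   (\sum_(k < n) \int[mu]_x (phi x * \1_(G (n - k)%N) x)%:E <= (C + eps * n%:R)%:E)%E.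
Proof.
move=> mphi phi0 iphi mG L0 eps eps0.
pose e m := fine (\int[mu]_x (phi x * \1_(G m) x)%:E)%E.
have ge0 m : (0 <= \int[mu]_x (phi x * \1_(G m) x)%:E)%E.
  by apply: integral_ge0 => x _; rewrite lee_fin mulr_ge0.
have eE m : (e m)%:E = (\int[mu]_x (phi x * \1_(G m) x)%:E)%E.
  rewrite fineK// ge0_fin_numE// (le_lt_trans _ iphi)//.
  apply: ge0_le_integral => //.
  - by move=> x _; rewrite lee_fin mulr_ge0.
  - by apply/measurable_EFinP/measurable_funM => //; exact: measurable_indic.
  - exact/measurable_EFinP.
  - by move=> x _; rewrite lee_fin indicE ler_piMr//; case: (_ \in _).
have ecvg : e @ \oo --> 0.
  by have /fine_cvgP[] := integral_indic_vanishing mphi phi0 iphi mG L0.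
have [|C hC] := sum_vanishing_le _ ecvg eps0; first by move=> m; exact: fine_ge0.
by exists C => n; under eq_bigr do rewrite -eE; rewrite sumEFin lee_fin.
Qed.

Lemma integral_cst_probability (k : R) : (\int[mu]_x (cst k x)%:E = k%:E)%E.
Proof.
rewrite (integral_cst mu measurableT k%:E).
exact: (etrans (congr1 (mule k%:E) (probability_setT mu)) (mule1 _)).
Qed.

(** If almost every point had only finitely many records, the integrated excess over the budget
    would be sublinear, so the integral of [a n] would be at most [c * n] plus a sublinear term,
    against the lower bound with [c' > c]. *)
Lemma record_set_positive T (a : nat -> Delta -> R) c c' :
  measure_preserving mu T -> (forall n, measurable_fun setT (a n)) ->
  (forall n x, 0 <= a n x) -> (forall x, a 0%N x = 0) ->
  (forall n m x, a (n + m)%N x <= a n x + a m (iter n T x)) ->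
  (\int[mu]_x (a 1%N x)%:E < +oo)%E -> 0 <= c -> c < c' ->
  (forall n, (c' * n%:R)%:E <= \int[mu]_x (a n x)%:E)%E ->
  mu (limsup_set (record_set T a c)) != 0%E.
Proof.
move=> Tmp ma age0 a0 asub ia c0 cc' hc'; apply/negP => /eqP L0.
have mG m : measurable (record_set T a c m) by exact: (measurable_record_set _ _ Tmp).
have [|C hC] := sum_integral_indic_le (ma 1%N) (age0 1%N) ia mG L0 (_ : 0 < (c' - c) / 2).
  lra.
have h n : c' * n%:R <= c * n%:R + (C + (c' - c) / 2 * n%:R).
  rewrite -lee_fin (le_trans (hc' n))//.
  have := @record_integral T (a n) (cst (c * n%:R)) (a 1%N) (record_set T a c) n Tmp.
  move=> /(_ (ma _) (measurable_cst _) (ma _) (age0 _) _ (age0 _) mG).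
  have p1 x : 0 <= @cst Delta _ (c * n%:R) x by rewrite mulr_ge0.
  move=> /(_ p1) r; apply: (le_trans (r _)).
    move=> x; apply: record_pointwise => //; first by move=> y; rewrite a0.
    by move=> y; rewrite lerDl.
  by rewrite integral_cst_probability EFinD leeD2l.
have c'c : 0 < c' - c by rewrite subr_gt0.
have := archi_boundP (normr_ge0 (2 * C / (c' - c))); set b := Num.bound _ => hb.
have := h b; have : 2 * C / (c' - c) < b%:R by apply: le_lt_trans hb; exact: ler_norm.
rewrite ltr_pdivrMr//; nra.
Qed.

Lemma birkhoff_sumD (S : Delta -> Delta) (f : Delta -> R) n m x :
  \sum_(l < n + m) f (iter l S x) =
    \sum_(l < n) f (iter l S x) + \sum_(l < m) f (iter l S (iter n S x)).
Proof.
by rewrite big_split_ord/=; congr (_ + _); apply: eq_bigr => i _; rewrite -iterD addnC.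
Qed.

(** A maximal ergodic inequality, obtained from records of the negated Birkhoff sums at rate [- c].
    No ergodicity is assumed of [S], so that it can be an iterate of an ergodic map. *)
Lemma birkhoff_sum_set_positive S (f : Delta -> R) c :
  measure_preserving mu S -> measurable_fun setT f -> (forall x, 0 <= f x) ->
  (\int[mu]_x (f x)%:E < c%:E)%E ->
  let E := [set x | forall j, \sum_(l < j) f (iter l S x) <= c * j%:R] in
  measurable E /\ mu E != 0%E.
Proof.
move=> Smp mf f0 ifc E.
have mS n : measurable_fun setT (fun x => \sum_(l < n) f (iter l S x)).
  by apply: measurable_sum => l; exact: (measurableT_comp mf (measurable_iter Smp _)).
have mE : measurable E.
  rewrite (_ : E = \bigcap_j [set x | \sum_(l < j) f (iter l S x) <= c * j%:R]).
    apply: bigcapT_measurable => j; rewrite -[X in measurable X]setTI.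
    have h : measurable_fun setT (fun x => \sum_(l < j) f (iter l S x) <= c * j%:R).
      exact: measurable_fun_ler.
    exact: (h measurableT [set true]).
  by apply/seteqP; split => x /= h j; [move=> _|]; exact: h.
split => //; apply/negP => /eqP E0.
pose a n x := - \sum_(l < n) f (iter l S x).
have ma n : measurable_fun setT (a n) by exact: measurableT_comp.
have mG m : measurable (record_set S a (- c) m) by exact: (measurable_record_set _ _ Smp).
have SD := birkhoff_sumD S f.
(* A record at horizon [m] says that the first [j] terms sum to at most [c * j] for every [j <= m];
   infinitely many records therefore put the point in [E]. *)
have L0 : mu (limsup_set (record_set S a (- c))) = 0%E.
  apply/eqP; rewrite eq_le measure_ge0 andbT -E0.
  apply: le_measure; rewrite ?inE//; first exact: measurable_limsup_set.
  move=> x hx [|j]; first by rewrite big_ord0 mulr0.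
  have [m jm /(_ j.+1)] := hx j.+1; rewrite ltn0Sn jm => /(_ isT).
  by rewrite /a; have := SD j.+1 (m - j.+1)%N x; rewrite subnKC// => ->; lra.
have if0 : (0 <= \int[mu]_x (f x)%:E)%E by apply: integral_ge0 => x _; rewrite lee_fin.
have c0 : 0 < c by rewrite -lte_fin (le_lt_trans if0).
pose I := fine (\int[mu]_x (f x)%:E)%E.
have IE : I%:E = (\int[mu]_x (f x)%:E)%E.
  by rewrite fineK// ge0_fin_numE// (lt_trans ifc)// ltry.
have Ic : I < c by rewrite -lte_fin IE.
have [|||C hC] := sum_integral_indic_le (measurable_cst c) _ _ mG L0 (_ : 0 < (c - I) / 2).
- by move=> x; exact: ltW.
- by rewrite integral_cst_probability ltry.
- lra.
have h n : c * n%:R <= I * n%:R + (C + (c - I) / 2 * n%:R).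
  have Sint : (\int[mu]_x (\sum_(l < n) f (iter l S x))%:E = (I * n%:R)%:E)%E.
    under eq_integral do rewrite -sumEFin.
    rewrite ge0_integral_sum//.
    - rewrite (eq_bigr (fun=> I%:E)); first by rewrite sumEFin sumr_const card_ord mulr_natr.
      move=> l _; rewrite IE (@integral_iter_measure_preserving S l (fun x => (f x)%:E))//.
        exact/measurable_EFinP.
    - by move=> l; apply/measurable_EFinP; exact: (measurableT_comp mf (measurable_iter Smp _)).
    - by move=> l x _; rewrite lee_fin.
  have := @record_integral S (cst (c * n%:R)) (fun x => \sum_(l < n) f (iter l S x))
     (cst c) (record_set S a (- c)) n Smp (measurable_cst _) (mS n) (measurable_cst _).
  rewrite Sint integral_cst_probability => r.
  rewrite -lee_fin (le_trans (r _ _ _ mG _))//.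
  - by move=> x; rewrite mulr_ge0// ltW.
  - by move=> x; rewrite sumr_ge0.
  - by move=> x; exact: ltW.
  (* The excess function can be the constant [c]: a single step of the negated sum is at most
     [0 = c - c]. *)
  - move=> x; have := @record_pointwise S a (- c) (cst c) _ _ _ _ n x.
    rewrite /a mulNr lerNl opprD opprK => q; rewrite -lerBlDr; apply: q.
    + by move=> y; rewrite big_ord0 oppr0.
    + by move=> k m y; rewrite SD opprD.
    + by move=> y; exact: ltW.
    + by move=> y; rewrite /= subrr big_ord1/= oppr_le0.
  by rewrite EFinD leeD2l.
have := archi_boundP (normr_ge0 (2 * C / (c - I))); set b := Num.bound _ => hb.
have cI : 0 < c - I by rewrite subr_gt0.
have := h b; have : 2 * C / (c - I) < b%:R by apply: le_lt_trans hb; exact: ler_norm.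
rewrite ltr_pdivrMr//; nra.
Qed.

(** The points visiting [E] form a set that is only nested under preimages. The set [B] of points
    visiting infinitely often is exactly invariant and, by continuity from above, has the same
    measure. *)
Lemma ergodic_enters T (E : set Delta) :
  measure_preserving mu T -> ergodic mu T -> measurable E -> mu E != 0%E ->
  {ae mu, forall x, exists n, E (iter n T x)}.
Proof.
move=> Tmp Terg mE E0.
pose B0 : set Delta := \bigcup_n iter n T @^-1` E.
have mpre n (B : set Delta) : measurable B -> measurable (iter n T @^-1` B).
  by move=> mB; rewrite -[X in measurable X]setTI; exact: measurable_iter.
have mB0 : measurable B0 by apply: bigcupT_measurable => n; exact: mpre.
pose F n := iter n T @^-1` B0.
have FS n : F n.+1 `<=` F n.
  move=> x [k _ /= h]; exists k.+1 => //=; rewrite -iterS iterSr.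
  exact: h.
pose B := \bigcap_n F n.
have mF n : measurable (F n) by exact: mpre.
have mB : measurable B by exact: bigcapT_measurable.
have TB : T @^-1` B = B.
  apply/seteqP; split => x /= h n _; last by rewrite /F/= -iterSr; exact: h.
  by apply: FS; rewrite /F /= -iterS iterSr; exact: h.
have cF : (mu \o F) @ \oo --> mu B.
  apply: nonincreasing_cvg_mu => //.
    by rewrite (le_lt_trans (probability_le1 _ _))// ltry.
  by apply/nonincreasing_seqP => n; apply/subsetPset/FS.
have muF : mu \o F = cst (mu B0).
  by apply/funext => n /=; rewrite (measure_preserving_iter Tmp n).2.
have muB : mu B = mu B0.
  by move: cF; rewrite muF => /cvg_lim <- //; rewrite lim_cst.
have B1 : mu B = 1%E.
  have [B00|//] := Terg _ mB TB.
  exfalso; move/negP : E0; apply; rewrite eq_le measure_ge0 andbT -B00 muB.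
  by apply: le_measure; rewrite ?inE// => x Ex; exists 0%N.
exists (~` B); split; first exact: measurableC.
  by rewrite probability_setC// B1 subee.
move=> x /= nx Bx; apply: nx; have [n _ hn] := Bx 0%N I.
by exists n.
Qed.

Lemma integral_small (g : nat -> Delta -> R) (h : Delta -> R) :
  (forall k, measurable_fun setT (g k)) -> measurable_fun setT h ->
  (forall k x, 0 <= g k x) -> (forall k x, g k x <= h x) ->
  (\int[mu]_x (h x)%:E < +oo)%E -> (forall x, g^~ x @ \oo --> 0) ->
  forall eps, 0 < eps -> exists k, (\int[mu]_x (g k x)%:E < eps%:E)%E.
Proof.
move=> mg mh g0 gh ih gcvg eps eps0.
have [] := @dominated_convergence _ _ _ mu _ measurableT
  (fun k x => (g k x)%:E) (cst 0%E) (fun x => (h x)%:E).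
- by move=> m; exact/measurable_EFinP.
- exact: measurable_cst.
- by apply: aeW => x _; apply/fine_cvgP; split; [near=> k|exact: gcvg].
- apply/integrableP; split; first exact/measurable_EFinP.
  under eq_integral do rewrite gee0_abs ?lee_fin ?(le_trans (g0 0%N _) (gh 0%N _))//.
  exact: ih.
- by apply: aeW => x m _; rewrite gee0_abs ?lee_fin.
move=> _ _; rewrite (integral_cst mu measurableT 0%E) mul0e => /fine_cvgP[[N1 _ h1]].
move=> /cvgrPdist_lt/(_ _ eps0)[N2 _ h2]; exists (maxn N1 N2).
have := h2 (maxn N1 N2) (leq_maxr _ _); rewrite /= sub0r normrN => h3.
rewrite -(@fineK _ (\int[mu]_x _)%E) ?lte_fin; last exact: (h1 _ (leq_maxl _ _)).
by apply: le_lt_trans h3; exact: ler_norm.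
Unshelve. all: by end_near. Qed.

Lemma archimedean_absorb (C eps : R) : 0 < eps ->
  exists N : nat, forall n, (N <= n)%N -> C <= eps * n%:R.
Proof.
move=> eps0; exists (Num.bound `|C / eps|) => n hn.
rewrite mulrC -ler_pdivrMr//.
apply: (le_trans (ler_norm _)); apply: ltW.
by apply: (lt_le_trans (archi_boundP (normr_ge0 _))); rewrite ler_nat.
Qed.

(** * Almost sure linear bounds under ergodicity *)

Section Rates.
Variable T : Delta -> Delta.
Hypothesis Tmp : measure_preserving mu T.
Hypothesis Terg : ergodic mu T.

(** Almost every orbit enters the set where all Birkhoff sums obey the rate midway between the
    integral and [c]; the sum before the entry time is absorbed by the remaining margin. *)
Lemma birkhoff_upper (f : Delta -> R) c :
  measurable_fun setT f -> (forall x, 0 <= f x) ->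
  (\int[mu]_x (f x)%:E < c%:E)%E ->
  {ae mu, forall x, exists N, forall n, (N <= n)%N ->
     \sum_(l < n) f (iter l T x) <= c * n%:R}.
Proof.
move=> mf f0 ifc.
have if0 : (0 <= \int[mu]_x (f x)%:E)%E by apply: integral_ge0 => x _; rewrite lee_fin.
pose I := fine (\int[mu]_x (f x)%:E)%E.
have IE : I%:E = (\int[mu]_x (f x)%:E)%E.
  by rewrite fineK// ge0_fin_numE// (lt_trans ifc)// ltry.
have Ic : I < c by rewrite -lte_fin IE.
have I0 : 0 <= I by rewrite -lee_fin IE.
have [|mE E0] := @birkhoff_sum_set_positive T f ((I + c) / 2) Tmp mf f0.
  by rewrite -IE lte_fin; lra.
apply: filterS (ergodic_enters Tmp Terg mE E0) => x [i hi].
have [N hN] := @archimedean_absorb (\sum_(l < i) f (iter l T x)) ((c - I) / 2) ltac:(lra).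
exists (maxn i N) => n; rewrite geq_max => /andP[ni nN].
have := hi (n - i)%N; have := hN n nN.
have := birkhoff_sumD T f i (n - i) x; rewrite subnKC// => ->.
have : (n - i)%:R <= n%:R :> R by rewrite ler_nat leq_subr.
set S1 := \sum_(_ < i) _; set S2 := \sum_(_ < _) _; nra.
Qed.

(** The part of [f] above a high level has integral below [eps / 4]. Its Birkhoff sum up to time [n]
    then bounds its last term, the value at time [n]. *)
Lemma tempered (f : Delta -> R) eps :
  measurable_fun setT f -> (forall x, 0 <= f x) ->
  (\int[mu]_x (f x)%:E < +oo)%E -> 0 < eps ->
  {ae mu, forall x, exists N, forall n, (N <= n)%N -> f (iter n T x) <= eps * n%:R}.
Proof.
move=> mf f0 iff eps0.
pose g (L : nat) x := Num.max (f x - L%:R) 0.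
have mg L : measurable_fun setT (g L).
  by apply: measurable_maxr => //; apply: measurable_funB.
have g0 L x : 0 <= g L x by rewrite le_max lexx orbT.
have gf L x : g L x <= f x by rewrite ge_max f0 andbT gerBl.
have gcvg x : g^~ x @ \oo --> 0.
  apply: cvg_near_cst; exists (Num.bound (f x)) => // k /= hk.
  apply/max_idPr; rewrite subr_le0 (le_trans (ltW (archi_boundP (f0 x))))//.
  by rewrite ler_nat.
have eps4 : 0 < eps / 4 by lra.
have [L iL] := integral_small mg mf g0 gf iff gcvg eps4.
apply: filterS (birkhoff_upper (mg L) (g0 L) iL) => x [N hN].
have [M hM] := @archimedean_absorb (L%:R + eps / 4) (eps / 4) ltac:(lra).
exists (maxn N M) => n; rewrite geq_max => /andP[nN nM].
have := hN n.+1 (leqW nN); have := hM n nM.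
rewrite big_ord_recr/=.
have : 0 <= \sum_(i < n) g L (iter i T x) by rewrite sumr_ge0.
have : f (iter n T x) - L%:R <= g L (iter n T x) by rewrite le_max lexx.
rewrite -[n.+1%:R]natr1; set S := \sum_(_ < _) _; set m := g _ _.
have : 0 <= eps * n%:R by rewrite mulr_ge0// ltW.
lra.
Qed.

Section Subadditive.
Variable a : nat -> Delta -> R.
Hypothesis ma : forall n, measurable_fun setT (a n).
Hypothesis age0 : forall n x, 0 <= a n x.
Hypothesis a0 : forall x, a 0%N x = 0.
Hypothesis asub : forall n m x, a (n + m)%N x <= a n x + a m (iter n T x).
Hypothesis ia : (\int[mu]_x (a 1%N x)%:E < +oo)%E.

Lemma subadditive_le_sum n x : a n x <= \sum_(l < n) a 1%N (iter l T x).
Proof.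
elim: n => [|n IH]; first by rewrite a0 big_ord0.
by rewrite big_ord_recr/= -addn1 (le_trans (asub _ _ _))// lerD.
Qed.

Lemma subadditive_le_blocks m j x :
  a (j * m)%N x <= \sum_(l < j) a m (iter l (iter m T) x).
Proof.
have itM l y : iter l (iter m T) y = iter (l * m) T y.
  by elim: l => //= l ->; rewrite mulSn iterD.
elim: j => [|j IH]; first by rewrite mul0n a0 big_ord0.
rewrite big_ord_recr/= mulSn addnC (le_trans (asub _ _ _))// lerD//.
by rewrite itM.
Qed.

Definition upper_rate c :=
  {ae mu, forall x, exists N, forall n, (N <= n)%N -> a n x <= c * n%:R}.

(** The orbit is cut into an initial piece, blocks of length [m], and a remainder shorter than [m].
    Since [iter m T] may fail to be ergodic, a good set of positive measure is found for it and
    entered by means of [T]. *)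
Lemma subadditive_upper m c c' :
  (0 < m)%N -> (\int[mu]_x (a m x)%:E < (c * m%:R)%:E)%E -> c < c' -> upper_rate c'.
Proof.
move=> m0 iam cc'.
have m0' : 0 < m%:R :> R by rewrite ltr0n.
have c0 : 0 < c.
  rewrite -(pmulr_lgt0 _ m0') -lte_fin (le_lt_trans _ iam)//.
  by apply: integral_ge0 => x _; rewrite lee_fin.
have [mE E0] := @birkhoff_sum_set_positive (iter m T) (a m) (c * m%:R)
   (measure_preserving_iter Tmp m) (ma m) (age0 m) iam.
set E := mkset _ in mE E0.
(* With this choice, fewer than [m] remainder terms, each at most [eps * n], use up at most half of
   the margin [(c' - c) * n]. *)
pose eps := (c' - c) / (2 * m%:R).
have eps0 : 0 < eps by rewrite divr_gt0 ?subr_gt0 ?mulr_gt0.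
have mt := tempered (ma 1%N) (age0 1%N) ia eps0.
have me := ergodic_enters Tmp Terg mE E0.
apply: filterS2 me mt => x [i hi] [N0 hN0].
have [N1 hN1] := @archimedean_absorb (a i x) ((c' - c) / 2) ltac:(lra).
exists (maxn (i + N0 + m) N1) => n; rewrite geq_max => /andP[nN0 nN1].
have ni : (i <= n)%N by rewrite (leq_trans _ nN0)// -addnA leq_addr.
set j := ((n - i) %/ m)%N; set r := ((n - i) %% m)%N.
have nE : n = (i + (j * m + r))%N by rewrite -divn_eq subnKC.
have rm : (r < m)%N by rewrite ltn_mod.
have h1 : a n x <= a i x + (a (j * m)%N (iter i T x) + a r (iter (j * m) T (iter i T x))).
  rewrite {1}nE (le_trans (asub _ _ _))// lerD2l; exact: asub.
have h2 : a (j * m)%N (iter i T x) <= c * n%:R.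
  apply: (le_trans (subadditive_le_blocks _ _ _)); apply: (le_trans (hi j)).
  rewrite -mulrA ler_wpM2l ?(ltW c0)// -natrM ler_nat mulnC.
  by rewrite (leq_trans (leq_trunc_div _ _))// leq_subr.
have h3 : a r (iter (j * m) T (iter i T x)) <= (c' - c) / 2 * n%:R.
  apply: (le_trans (subadditive_le_sum _ _)).
  apply: (@le_trans _ _ (\sum_(l < r) eps * n%:R)).
    apply: ler_sum => l _; rewrite -!iterD.
    apply: (le_trans (hN0 _ _)).
      have : (i + N0 + m <= i + (j * m + r))%N by rewrite -nE.
      by have := ltn_ord l; lia.
    rewrite ler_wpM2l ?(ltW eps0)// ler_nat nE.
    by have := ltn_ord l; lia.
  rewrite sumr_const card_ord -(mulr_natl (eps * n%:R)) mulrA ler_wpM2r//.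
  apply: (@le_trans _ _ (m%:R * eps)).
    by rewrite ler_wpM2r ?(ltW eps0)// ler_nat ltnW.
  rewrite /eps le_eqVlt; apply/orP; left; apply/eqP; field.
  by rewrite lt0r_neq0.
have := hN1 n nN1; lra.
Qed.

(** The dichotomy is at the midpoint of [c] and [c']: either one integral falls below that rate,
    which forces the upper bound, or none does and records recur. *)
Lemma upper_rate_or_record c c' : 0 <= c -> c < c' -> ~ upper_rate c' ->
  {ae mu, forall x, exists i, limsup_set (record_set T a c) (iter i T x)}.
Proof.
move=> c0 cc' nU.
have h n : (((c + c') / 2 * n%:R)%:E <= \int[mu]_x (a n x)%:E)%E.
  rewrite leNgt; apply/negP => hn; apply: nU; apply: (@subadditive_upper n ((c + c') / 2)).
  - rewrite lt0n; apply/negP => /eqP n0; move: hn; rewrite n0 mulr0 ltNge.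
    by rewrite integral_ge0// => x _; rewrite lee_fin.
  - by [].
  - lra.
apply: ergodic_enters => //.
  by apply: measurable_limsup_set => m; exact: measurable_record_set.
by apply: (@record_set_positive T a c ((c + c') / 2)) => //; lra.
Qed.

End Subadditive.
End Rates.

End Ergodic.

(** * Measurability of the volume growth *)

Section Volume.
Set Implicit Arguments.
Unset Strict Implicit.
Variable R : realType.

Lemma cvg_det (I : Type) (F : set_system I) {FF : Filter F} n (M : I -> 'M[R]_n) (L : 'M[R]_n) :
  (forall i j, M t i j @[t --> F] --> L i j) ->
  \det (M t) @[t --> F] --> \det L.
Proof.
move=> ML; rewrite /determinant; apply: cvg_big => //; first exact: add_continuous.
move=> s _; apply: cvgM; first exact: cvg_cst.
by apply: cvg_big => // ; exact: mul_continuous.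
Qed.

Lemma cvg_gram (I : Type) (F : set_system I) {FF : Filter F} p q (M : I -> 'M[R]_(p, q)) (L : 'M[R]_(p, q)) :
  (forall i j, M t i j @[t --> F] --> L i j) ->
  gram (M t) @[t --> F] --> gram L.
Proof.
move=> ML; apply: cvg_det => i j; rewrite mxE.
under eq_cvg do rewrite mxE.
apply: cvg_big => //; first exact: add_continuous.
by move=> k _; rewrite mxE; under eq_cvg do rewrite mxE; apply: cvgM.
Qed.

Lemma cvg_mulmxl (I : Type) (F : set_system I) {FF : Filter F} p q r (B : 'M[R]_(r, p))
    (M : I -> 'M[R]_(p, q)) (L : 'M[R]_(p, q)) :
  (forall i j, M t i j @[t --> F] --> L i j) ->
  forall i j, (B *m M t) i j @[t --> F] --> (B *m L) i j.
Proof.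
move=> ML i j; rewrite mxE; under eq_cvg do rewrite mxE.
apply: cvg_big => //; first exact: add_continuous.
by move=> k _; apply: cvgM => //; exact: cvg_cst.
Qed.

Lemma gramZ p q (a : R) (X : 'M[R]_(p, q)) : gram (a *: X) = (a ^+ q) ^+ 2 * gram X.
Proof. by rewrite -mul_mx_scalar gramMr det_scalar mulrC. Qed.

Definition intmx p q (Z : 'M[int]_(p, q)) : 'M[R]_(p, q) := map_mx intr Z.

(** The inequality is open and invariant under scaling of the frame, so a rational approximation of
    [X] can be cleared of its denominator. *)
Lemma gram_int_dense p q (B : 'M[R]_p) (X : 'M[R]_(p, q)) c :
  gram X != 0 -> c * gram X < gram (B *m X) ->
  exists2 Z : 'M[int]_(p, q), gram (intmx Z) != 0 &
     c * gram (intmx Z) < gram (B *m intmx Z).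
Proof.
move=> gX cX.
pose Z (n : nat) : 'M[int]_(p, q) := \matrix_(i, j) Num.floor (n.+1%:R * X i j).
pose Y n := n.+1%:R^-1 *: intmx (Z n).
have Ycvg i j : Y n i j @[n --> \oo] --> X i j.
  apply/cvgrPdist_le => e e0.
  have [N hN] := @archimedean_absorb R 1 e e0.
  exists N => // n /= Nn; rewrite !mxE.
  have n0 : 0 < n.+1%:R :> R by rewrite ltr0n.
  have /andP[f1 f2] := floor_itv (n.+1%:R * X i j).
  rewrite intrD in f2.
  have -> : X i j - n.+1%:R^-1 * (Num.floor (n.+1%:R * X i j))%:~R =
     n.+1%:R^-1 * (n.+1%:R * X i j - (Num.floor (n.+1%:R * X i j))%:~R).
    by rewrite mulrBr mulKf// gt_eqF.
  rewrite normrM gtr0_norm ?invr_gt0// mulrC ler_pdivrMr//.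
  rewrite ger0_norm ?subr_ge0// (le_trans _ (hN n.+1 (leqW Nn)))//.
  by rewrite lerBlDr addrC ltW.
have c1 : gram (Y n) @[n --> \oo] --> gram X by exact: cvg_gram.
have c2 : gram (B *m Y n) @[n --> \oo] --> gram (B *m X).
  by apply: cvg_gram; exact: cvg_mulmxl.
have c3 : gram (B *m Y n) - c * gram (Y n) @[n --> \oo] --> gram (B *m X) - c * gram X.
  by apply: cvgB => //; apply: cvgM => //; exact: cvg_cst.
have gX0 : 0 < gram X by rewrite lt_neqAle gram_ge0 andbT eq_sym.
have [N1 _ h1] := cvgr_gt _ c1 _ gX0.
have d0 : 0 < gram (B *m X) - c * gram X by rewrite subr_gt0.
have [N2 _ h2] := cvgr_gt _ c3 _ d0.
pose N := maxn N1 N2.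
have {}h1 := h1 N (leq_maxl _ _); have {}h2 := h2 N (leq_maxr _ _).
rewrite /= in h1 h2.
have k0 : 0 < (N.+1%:R^-1 ^+ q) ^+ 2 :> R by rewrite !exprn_gt0// invr_gt0 ltr0n.
exists (Z N).
  by apply: contraTneq h1 => h; rewrite /Y gramZ h mulr0 ltxx.
move: h2; rewrite /Y -scalemxAr !gramZ subr_gt0 mulrCA.
by rewrite ltr_pM2l.
Qed.

(** Superlevel sets of [vol2] become countable unions over integer frames, which gives
    measurability. For [c >= 0] a degenerate frame, of value 0, cannot witness the strict
    inequality. *)
Lemma vol2_gtP p q (B : 'M[R]_p) c : 0 <= c ->
  c < vol2 q B <-> exists2 Z : 'M[int]_(p, q), gram (intmx Z) != 0 &
     c * gram (intmx Z) < gram (B *m intmx Z).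
Proof.
move=> c0; split=> [cv|[Z gZ h]].
  have e0 : 0 < vol2 q B - c by rewrite subr_gt0.
  have [_ [X _ <-]] := sup_adherent e0 (vol2_has_sup q B).
  rewrite -/(vol2 q B) subKr => h.
  have gX : gram X != 0.
    apply/negP => /eqP g0; move: h; rewrite g0 invr0 mulr0 ltNge c0//.
  apply: (gram_int_dense gX).
  by rewrite -ltr_pdivlMr// lt_neqAle gram_ge0 andbT eq_sym.
have gZ0 : 0 < gram (intmx Z) by rewrite lt_neqAle gram_ge0 andbT eq_sym.
rewrite -(ltr_pM2r gZ0) (lt_le_trans h)//; exact: gram_le_vol2.
Qed.

Lemma measurable_det (d : measure_display) (D : measurableType d) n (M : D -> 'M[R]_n) :
  (forall i j, measurable_fun setT (fun x => M x i j)) ->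
  measurable_fun setT (fun x => \det (M x)).
Proof.
move=> mM; rewrite /determinant; apply: measurable_sum => s.
apply: measurable_funM => //; exact: measurable_prod.
Qed.

Lemma measurable_mulmx (d : measure_display) (D : measurableType d) m n r
    (M : D -> 'M[R]_(m, n)) (N : D -> 'M[R]_(n, r)) :
  (forall i j, measurable_fun setT (fun x => M x i j)) ->
  (forall i j, measurable_fun setT (fun x => N x i j)) ->
  forall i j, measurable_fun setT (fun x => (M x *m N x) i j).
Proof.
move=> mM mN i j; under eq_fun do rewrite mxE.
by apply: measurable_sum => k; exact: measurable_funM.
Qed.

Lemma measurable_gram (d : measure_display) (D : measurableType d) p q
    (M : D -> 'M[R]_(p, q)) :
  (forall i j, measurable_fun setT (fun x => M x i j)) ->
  measurable_fun setT (fun x => gram (M x)).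
Proof.
move=> mM; apply: measurable_det => i j; apply: measurable_mulmx => // k l.
by under eq_fun do rewrite mxE; exact: mM.
Qed.

Lemma measurable_vol2 (d : measure_display) (D : measurableType d) p q (M : D -> 'M[R]_p) :
  (forall i j, measurable_fun setT (fun x => M x i j)) ->
  measurable_fun setT (fun x => vol2 q (M x)).
Proof.
move=> mM mD; apply: (measurability _ (RGenOInfty.measurableE R)) => //.
move=> /= _ [_ [c ->] <-]; rewrite setTI preimage_itvoy.
have [c0|c0] := ltP c 0.
  rewrite (_ : [set _ | _] = setT)//; apply/seteqP; split => x //= _.
  exact: lt_le_trans c0 (vol2_ge0 _ _).
rewrite (_ : [set _ | _] = \bigcup_(Z : 'M[int]_(p, q))
   [set x | c * gram (intmx Z) < gram (M x *m intmx Z)]).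
  apply: countable_bigcupT_measurable => // Z.
  rewrite -[X in measurable X]setTI.
  have h : measurable_fun setT (fun x => c * gram (intmx Z) < gram (M x *m intmx Z)).
    apply: measurable_fun_ltr => //; apply: measurable_gram.
    exact: measurable_mulmx.
  exact: (h measurableT [set true]).
apply/seteqP; split => x /=; first by move=> /(vol2_gtP _ _ c0)[Z gZ h]; exists Z.
move=> [Z _ h]; apply/(vol2_gtP _ _ c0); exists Z => //.
by apply: contraTneq h => g0; rewrite g0 mulr0 gram_mull_eq0// ltxx.
Qed.

End Volume.

(** * Uniform growth along record times *)

Section Growth.
Set Implicit Arguments.
Unset Strict Implicit.
Variable R : realType.

Lemma sqnD_le p (u v : 'cV[R]_p) : sqn (u + v) <= 2 * sqn u + 2 * sqn v.
Proof.
rewrite /sqn !mulr_sumr -big_split/= ler_sum// => i _; rewrite mxE.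
by have := sqr_ge0 (u i 0 - v i 0); nra.
Qed.

Lemma sqnB p (u v : 'cV[R]_p) : sqn (u - v) = sqn (v - u).
Proof. by rewrite -opprB -scaleN1r sqnZ sqrrN expr1n mul1r. Qed.

Lemma unit_seq_cluster p (g : nat -> 'cV[R]_p) : (forall k, sqn (g k) = 1) ->
  exists v, forall e, 0 < e -> forall k0, exists2 k, (k0 <= k)%N & sqn (v - g k) < e.
Proof.
move=> g1.
have cK := @rV_compact R p (fun=> `[-1, 1]%classic) (fun=> @segment_compact R (-1) 1).
set K := (X in compact X) in cK.
have [|v [_ cv]] := cK ((fun k => (g k)^T) @ \oo) _.
  exists 0%N => // k _ i /=; rewrite mxE in_itv/= -ler_norml.
  rewrite -(@ler_pXn2r _ 2) ?nnegrE// real_normK ?num_real// expr1n -(g1 k).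
  exact: sqr_entry_le.
exists v^T => e e0 k0.
(* Each squared entry will be at most [s <= r], and [p] copies of [e / p.+1] sum to less than [e].
   The cap at 1 ensures that the square of a number below [s] is at most [s]. *)
pose r := e / (p.+1%:R) .
have r0 : 0 < r by rewrite divr_gt0.
pose s := Num.min r 1.
have s0 : 0 < s by rewrite lt_min r0 ltr01.
have [_ [/= [k k0k <-] bk]] : ([set (g k)^T | k in [set k | (k0 <= k)%N]]
    `&` ball v s) !=set0.
  apply: cv; last exact: nbhsx_ballx.
  by exists k0 => // k /= kk; exists k.
exists k => //.
have h i : ((v^T - g k) i 0) ^+ 2 <= s.
  have := bk.2 0 i; rewrite -ball_normE /= !mxE => /ltW h.
  rewrite -real_normK ?num_real// expr2.
  have s1 : s <= 1 by rewrite ge_min lexx orbT.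
  by rewrite -[leRHS]mulr1 ler_pM// (le_trans h).
apply: (le_lt_trans (ler_sum _ (fun i _ => h i))).
rewrite sumr_const card_ord -mulr_natl.
apply: (@le_lt_trans _ _ (p%:R * r)); first by rewrite ler_wpM2l// ge_min lexx.
by rewrite /r mulrCA gtr_pMr// ltr_pdivrMr ?ltr0n// mul1r ltr_nat.
Qed.

Lemma linear_matrix p (f : {linear 'cV[R]_p -> 'cV[R]_p}) :
  exists B : 'M[R]_p, forall v, f v = B *m v.
Proof.
exists (\matrix_(i, j) f (delta_mx j 0) i 0) => v.
rewrite {1}(matrix_sum_delta v) linear_sum; apply/matrixP => i k; rewrite ord1 summxE mxE.
apply: eq_bigr => j _; rewrite big_ord1 linearZ !mxE mulrC.
by [].
Qed.

(** A subspace is closed, being the kernel of the matrix of the identity minus a projection. *)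
Lemma vspace_limit p (G0 : {vspace 'cV[R]_p}) (v : 'cV[R]_p) :
  (forall e, 0 < e -> exists2 g, g \in G0 & sqn (v - g) < e) -> v \in G0.
Proof.
move=> h.
pose f : 'End('cV[R]_p) := \1%VF - projv G0.
have [B hB'] := linear_matrix f.
have hB u : u - projv G0 u = B *m u.
  by rewrite -hB' /= /f add_lfunE opp_lfunE id_lfunE.
have kerB g : g \in G0 -> B *m g = 0.
  by move=> gG; rewrite -hB projv_id// subrr.
suff : B *m v = 0.
  rewrite -hB => /eqP; rewrite subr_eq0 => /eqP ->.
  exact: memv_proj.
apply: sqn_eq0; apply/eqP; rewrite eq_le sqn_ge0 andbT; apply/ler_addgt0Pr => e e0; rewrite add0r.
have a0 : 0 < absum B ^+ 2 + 1 by rewrite ltr_wpDl// sqr_ge0.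
have [|g gG hg] := h (e / (absum B ^+ 2 + 1)); first by rewrite divr_gt0.
rewrite -[B *m v]subr0 -(kerB g gG) -mulmxBr (le_trans (sqn_mul_le _ _))//.
move: hg; rewrite ltr_pdivlMr// => hg.
have := sqn_ge0 (v - g); nra.
Qed.

Definition slow p (M : nat -> 'M[R]_p) (eta : R) (v : 'cV[R]_p) :=
  exists C, forall n, sqn (M n *m v) <= C * expR (eta * n%:R).

Lemma slow_comb p (M : nat -> 'M[R]_p) eta a u v :
  slow M eta u -> slow M eta v -> slow M eta (a *: u + v).
Proof.
move=> [C hC] [D hD]; exists (2 * a ^+ 2 * C + 2 * D) => n.
rewrite mulmxDr -scalemxAr (le_trans (sqnD_le _ _))// sqnZ.
have := hC n; have := hD n; have := sqr_ge0 a.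
set e := expR _; nra.
Qed.

Lemma slow_mono p (M : nat -> 'M[R]_p) eta eta' v : eta <= eta' ->
  slow M eta v -> slow M eta' v.
Proof.
move=> ee [C hC]; exists C => n; apply: (le_trans (hC n)).
have C0 : 0 <= C.
  have := hC 0%N; rewrite mulr0 expR0 mulr1; apply: le_trans; exact: sqn_ge0.
by rewrite ler_wpM2l// ler_expR ler_wpM2r.
Qed.

(** A decreasing sequence of subspaces meeting trivially in [G0] is already trivial in [G0] from
    some index on. Induction on the dimension: if some [E m0] does not contain [G0], its trace on
    [G0] is a smaller space. *)
Lemma decreasing_subspaces p (E : nat -> 'cV[R]_p -> Prop) :
  (forall m n v, (m <= n)%N -> E n v -> E m v) ->
  (forall m a u v, E m u -> E m v -> E m (a *: u + v)) ->
  forall G0 : {vspace 'cV[R]_p},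
  (forall v, v \in G0 -> (forall m, E m v) -> v = 0) ->
  exists m, forall v, v \in G0 -> E m v -> v = 0.
Proof.
move=> Emono Ecomb G0; move: {2}(\dim G0) (leqnn (\dim G0)) => k.
elim: k G0 => [|k IH] G0 dG hG.
  exists 0%N => v vG _; apply/eqP.
  have /eqP G00 : G0 == 0%VS by rewrite -dimv_eq0 -leqn0.
  by move: vG; rewrite G00 memv0.
have [allE|] := pselect (forall m v, v \in G0 -> E m v).
  by exists 0%N => v vG _; apply: hG => // m; exact: allE.
move=> /existsNP[m0 /existsNP[u0 /not_implyP[u0G nEu0]]].
pose Q (k : nat) := `[< exists2 U : {vspace 'cV[R]_p}, \dim U = k &
   (U <= G0)%VS /\ forall v, v \in U -> E m0 v >].
have [E0|nE0] := pselect (E m0 0); last first.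
  exists m0 => v vG Ev; exfalso; apply: nE0.
  have := Ecomb m0 (-1) _ _ Ev Ev; by rewrite scaleN1r addNr.
have exQ : exists k, Q k.
  exists 0%N; apply/asboolP; exists 0%VS; first exact: dimv0.
  by split; [exact: sub0v|move=> v; rewrite memv0 => /eqP ->].
have ubQ k' : Q k' -> (k' <= \dim G0)%N.
  by move=> /asboolP[U <- [UG _]]; exact: dimvS.
case: (ex_maxnP exQ ubQ) => k1 /asboolP[U dU [UG UE]] maxk.
(* [U] has maximal dimension among subspaces of [G0] inside [E m0]; adding the line of [v] keeps
   both properties, so [v] was already in [U]. *)
have inU v : v \in G0 -> E m0 v -> v \in U.
  move=> vG Ev.
  have Q' : Q (\dim (<[v]> + U)%VS).
    apply/asboolP; exists (<[v]> + U)%VS => //; split.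
      by rewrite subv_add UG andbT -memvE.
    move=> _ /memv_addP[_ /vlineP[a ->] [w wU ->]].
    by apply: Ecomb => //; exact: UE.
  have := maxk _ Q'; rewrite -dU => dle.
  have /eqP -> : U == (<[v]> + U)%VS by rewrite eqEdim addvSr.
  by apply: (subvP (addvSl _ _)); exact: memv_line.
have dUk : (\dim U <= k)%N.
  rewrite -ltnS (leq_trans _ dG)// ltn_neqAle dimvS// andbT.
  apply/negP => /eqP dUG; apply: nEu0; apply: UE.
  by have /eqP -> : U == G0 by rewrite eqEdim UG dUG leqnn.
have [|m hm] := IH U dUk.
  by move=> v vU hv; apply: hG => //; exact: (subvP UG).
exists (maxn m m0) => v vG Ev; apply: hm.
  by apply: inU => //; apply: Emono Ev; exact: leq_maxr.
by apply: Emono Ev; exact: leq_maxl.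
Qed.

(** [P n N] stands for the product of the matrices from time [n] to time [N]. The constants [C] and
    [K] leave room for records that start only after an initial stretch of the orbit. *)
Definition record_time p q (M : nat -> 'M[R]_p) (P : nat -> nat -> 'M[R]_p)
    (c C : R) (K N : nat) :=
  [/\ 0 < vol2 q (M N), expR (c * N%:R) <= C * vol2 q (M N) &
      forall n, (K <= n <= N)%N ->
        vol2 q (P n N) * expR (c * n%:R) <= C * vol2 q (M N)].

(** Removing from [g] its component in a nearly optimal frame [X] leaves the slow vector [f]. That
    component is small: its image is no longer than the image of [g], yet [M N] expands the span of
    [X]. *)
Lemma slow_part p q (M : nat -> 'M[R]_p) (P : nat -> nat -> 'M[R]_p)
    (L L' eps chi C : R) (K N1 N : nat) (g : 'cV[R]_p) :
  0 < C -> (forall n N, (n <= N)%N -> M N = P n N *m M n) ->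
  (forall n, (N1 <= n)%N -> vol2 (1 + (1 + q)) (M n) <= expR ((L + eps) * n%:R)) ->
  vol2 q (M N) <= expR (L' * N%:R) ->
  record_time (1 + q) M P (L - eps) C K N ->
  sqn (M N *m g) < expR (chi * N%:R) ->
  exists f, sqn (g - f) <= 2 * C * expR ((chi + L' - (L - eps)) * N%:R) /\
   forall n, (maxn K N1 <= n <= N)%N -> sqn (M n *m f) <= 2 * C * expR (2 * eps * n%:R) * sqn f.
Proof.
move=> C0 MP hw hq [V0 VN hP] gchi; set B := M N in V0 VN hP hq gchi *.
set V := vol2 (1 + q) B in V0 VN hP *.
have [X [gX gBX VX]] := vol2_near_max V0; rewrite -/V in VX.
have gB0 : 0 < gram (B *m X) by rewrite lt_neqAle gram_ge0 andbT eq_sym.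
(* The orthogonality is imposed on the images at time [N], so [c] solves the normal equations of
   [B *m X], not those of [X]. *)
have [c hc] := normal_eq (B *m g) gBX.
rewrite -mulmxA -mulmxBr in hc.
exists (g - X *m c); set f := g - X *m c in hc *; split.
  rewrite subKr.
  have hs : sqn (B *m (X *m c)) <= expR (chi * N%:R).
    apply: (le_trans _ (ltW gchi)).
    rewrite -(subrK (X *m c) g) -/f mulmxDr [leRHS]sqn_orth ?lerDr ?sqn_ge0//.
    by rewrite (mulmxA B X c) mulmxA tr_orth// mul0mx.
  have e0 : 0 < expR (chi * N%:R) by exact: expR_gt0.
  have e1 : 0 < expR (L' * N%:R) by exact: expR_gt0.
  have kB := fast_estimate B X c.
  have gX0 := gram_ge0 X.
  have s0 := sqn_ge0 (X *m c).
  have h1 : gram (B *m X) * sqn (X *m c) <=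
      expR (chi * N%:R) * expR (L' * N%:R) * gram X.
    apply: (le_trans kB); rewrite ler_wpM2r// ler_pM// ?sqn_ge0 ?vol2_ge0//.
  have h2 : V * sqn (X *m c) <= 2 * (expR (chi * N%:R) * expR (L' * N%:R)).
    rewrite -(ler_pM2l gB0) mulrCA (le_trans (ler_wpM2l (ltW V0) h1))//.
    have := ler_wpM2l (ltW (mulr_gt0 e0 e1)) VX; lra.
  have h3 : expR ((L - eps) * N%:R) * sqn (X *m c) <=
      2 * C * (expR (chi * N%:R) * expR (L' * N%:R)).
    by have := ler_wpM2l (ltW C0) h2; have := ler_wpM2r s0 VN; lra.
  have -> : (chi + L' - (L - eps)) * N%:R = - ((L - eps) * N%:R) + (chi * N%:R + L' * N%:R).
    by ring.
  rewrite !expRD expRN mulrCA [leRHS]mulrC ler_pdivlMr ?expR_gt0//.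
  by rewrite [leLHS]mulrC.
move=> n /andP[]; rewrite geq_max => /andP[Kn N1n] nN.
have PM := MP n N nN.
have kA := @slow_estimate _ _ _ (P n N) (M n) X f; rewrite -PM -/B in kA.
have {}kA := kA hc.
have hv := hP n (introT andP (conj Kn nN)).
have hn := hw n N1n.
have h1 : vol2 (1 + q) (P n N) * vol2 (1 + (1 + q)) (M n) <= C * V * expR (2 * eps * n%:R).
  apply: (le_trans (ler_wpM2l (vol2_ge0 _ _) hn)).
  have -> : (L + eps) * n%:R = (L - eps) * n%:R + 2 * eps * n%:R by ring.
  by rewrite expRD mulrA ler_wpM2r// expR_ge0.
rewrite -(ler_pM2r gB0); apply: (le_trans kA).
apply: (le_trans (ler_wpM2r _ h1)); first by rewrite mulr_ge0 ?sqn_ge0 ?gram_ge0.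
have : 0 <= C * expR (2 * eps * n%:R) * sqn f by rewrite !mulr_ge0 ?expR_ge0 ?sqn_ge0// ltW.
move=> /ler_wpM2l/(_ _ _ VX); lra.
Qed.

Lemma expR_decay (a e : R) : a < 0 -> 0 < e ->
  exists N0 : nat, forall N, (N0 <= N)%N -> expR (a * N%:R) <= e.
Proof.
move=> a0 e0; exists (Num.bound `|ln e / a|) => N hN.
rewrite -[leRHS](lnK (x := e)) ?posrE// ler_expR -ler_ndivrMl//.
rewrite mulrC; apply: (le_trans (ler_norm _)); apply: ltW.
by apply: (lt_le_trans (archi_boundP (normr_ge0 _))); rewrite ler_nat.
Qed.

(* If growth fails at every record time, the slow parts of the offending unit
   vectors accumulate at a vector of G0 that never grows faster than
   expR (2 * eps * n). *)
Lemma uniform_growth p q (M : nat -> 'M[R]_p) (P : nat -> nat -> 'M[R]_p)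
    (G0 : {vspace 'cV[R]_p}) (L L' eps chi C : R) (K N1 : nat) :
  0 < C -> 0 <= eps -> (forall n N, (n <= N)%N -> M N = P n N *m M n) ->
  (forall n, (N1 <= n)%N -> vol2 (1 + (1 + q)) (M n) <= expR ((L + eps) * n%:R)) ->
  (forall n, (N1 <= n)%N -> vol2 q (M n) <= expR (L' * n%:R)) ->
  (forall N0, exists2 N, (N0 <= N)%N & record_time (1 + q) M P (L - eps) C K N) ->
  chi + L' < L - eps ->
  (forall g, g \in G0 -> slow M (2 * eps) g -> g = 0) ->
  forall N0, exists2 N, (N0 <= N)%N &
    forall g, g \in G0 -> expR (chi * N%:R) * sqn g <= sqn (M N *m g).
Proof.
move=> C0 eps0 MP hw hq hrec gap hG N0; apply: contrapT => hno.
have bad N : (N0 <= N)%N -> exists g, [/\ g \in G0, sqn g = 1 &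
    sqn (M N *m g) < expR (chi * N%:R)].
  move=> NN0; have : ~ forall g, g \in G0 -> expR (chi * N%:R) * sqn g <= sqn (M N *m g).
    by move=> h; apply: hno; exists N.
  move=> /existsNP[g /not_implyP[gG /negP]]; rewrite -ltNge => hg.
  have g0 : 0 < sqn g.
    rewrite lt_neqAle sqn_ge0 andbT eq_sym; apply/negP => /eqP g0.
    by move: hg; rewrite g0 mulr0 ltNge sqn_ge0.
  exists ((Num.sqrt (sqn g))^-1 *: g); split; first exact: memvZ.
    by rewrite sqnZ exprVn sqr_sqrtr ?ltW// mulVf// gt_eqF.
  rewrite -scalemxAr sqnZ exprVn sqr_sqrtr ?ltW// mulrC ltr_pdivrMr//.
have gap0 : chi + L' - (L - eps) < 0 by rewrite subr_lt0.
have step k : exists gf : 'cV[R]_p * 'cV[R]_p, [/\ gf.1 \in G0, sqn gf.1 = 1,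
    sqn (gf.1 - gf.2) <= k.+1%:R^-1 &
    forall n, (maxn K N1 <= n <= k)%N ->
      sqn (M n *m gf.2) <= 2 * C * expR (2 * eps * n%:R) * sqn gf.2].
  have [|Nk hNk] := @expR_decay (chi + L' - (L - eps)) (k.+1%:R^-1 / (2 * C)) gap0.
    by rewrite divr_gt0 ?invr_gt0 ?ltr0n// mulr_gt0.
  have [N hN rN] := hrec (maxn (maxn N0 N1) (maxn k Nk)).
  move: hN; rewrite !geq_max => /andP[/andP[NN0 NN1] /andP[kN NkN]].
  have [g [gG g1 gchi]] := bad N NN0.
  have [f [hf1 hf2]] := slow_part C0 MP hw (hq N NN1) rN gchi.
  exists (g, f); split => //=.
    apply: (le_trans hf1); have := hNk N NkN; rewrite ler_pdivlMr ?mulr_gt0// mulrC.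
    by [].
  move=> n /andP[n1 n2]; apply: hf2; rewrite n1; exact: leq_trans kN.
have [gf hgf] := choice step.
have [v hv] := @unit_seq_cluster _ (fun k => (gf k).1) (fun k => let: And4 _ h _ _ := hgf k in h).
have vG : v \in G0.
  apply: vspace_limit => e e0; have [k _ hk] := hv e e0 0%N.
  by exists (gf k).1 => //; have [] := hgf k.
have v0 : v <> 0.
  move=> v0; have [k _ hk] := hv 1 ltr01 0%N.
  have [_ g1 _ _] := hgf k.
  by move: hk; rewrite v0 sqnB subr0 g1 ltxx.
apply: v0; apply: hG => //.
(* For fixed [n], [v] is approximated by a slow part [f] with [sqn f <= 4], closely enough that the
   image of the error has squared norm at most 1. Doubling both contributions gives [16 * C + 2]. *)
have tail n : (maxn K N1 <= n)%N -> sqn (M n *m v) <= (16 * C + 2) * expR (2 * eps * n%:R).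
  move=> n0; pose a := absum (M n) ^+ 2.
  have a0 : 0 <= a by exact: sqr_ge0.
  have e0 : 0 < (4 * (a + 1))^-1 by rewrite invr_gt0; lra.
  have [N hN] := @archimedean_absorb R 1 _ e0.
  have [k kN hk] := hv _ e0 (maxn n N).
  move: kN; rewrite geq_max => /andP[kn kN].
  have [_ g1 gf1 gf2] := hgf k; set g := (gf k).1 in g1 gf1 hk; set f := (gf k).2 in gf1 gf2.
  have d1 : sqn (g - f) <= (4 * (a + 1))^-1.
    apply: (le_trans gf1); rewrite -div1r ler_pdivrMr ?ltr0n//.
    exact: hN (leqW kN).
  have a4 : (4 * (a + 1))^-1 * (4 * (a + 1)) = 1 by rewrite mulVf// gt_eqF//; lra.
  set t := (4 * (a + 1))^-1 in e0 hk d1 a4.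
  have d2 : sqn (v - f) <= 4 * t.
    rewrite -(subrK g v) -addrA; apply: (le_trans (sqnD_le _ _)).
    by lra.
  have f4 : sqn f <= 4.
    rewrite -(subrK g f); apply: (le_trans (sqnD_le _ _)); rewrite sqnB g1.
    nra.
  rewrite -(subrK f v) mulmxDr addrC; apply: (le_trans (sqnD_le _ _)).
  have h1 : sqn (M n *m (v - f)) <= a * (4 * t).
    by apply: (le_trans (sqn_mul_le _ _)); rewrite ler_wpM2l.
  have h2 := gf2 n (introT andP (conj n0 kn)).
  have E1 : 1 <= expR (2 * eps * n%:R) by rewrite -expR0 ler_expR !mulr_ge0.
  set E := expR _ in h2 E1 *.
  have h3 : 2 * C * E * sqn f <= 2 * C * E * 4.
    by rewrite ler_wpM2l// !mulr_ge0//; lra.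
  nra.
(* The finitely many times before the tail estimate are covered by adding their values to the
   constant. *)
exists (16 * C + 2 + \sum_(n < maxn K N1) sqn (M n *m v)) => n.
have E1 : 1 <= expR (2 * eps * n%:R) by rewrite -expR0 ler_expR !mulr_ge0.
have S0 : 0 <= \sum_(n < maxn K N1) sqn (M n *m v).
  by apply: sumr_ge0 => *; exact: sqn_ge0.
have [n0|n0] := leqP (maxn K N1) n.
  apply: (le_trans (tail n n0)); rewrite ler_wpM2r ?expR_ge0// lerDl//.
have h : sqn (M n *m v) <= \sum_(n < maxn K N1) sqn (M n *m v).
  rewrite (bigD1 (Ordinal n0))//= lerDl; apply: sumr_ge0 => *; exact: sqn_ge0.
nra.
Qed.

End Growth.

(** * Expansion of transverse subspaces *)

Section Cocycle.
Set Implicit Arguments.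
Unset Strict Implicit.
Context (d : measure_display) (R : realType) (Delta : measurableType d).
Variables (mu : probability Delta R) (p : nat).
Variables (T : Delta -> Delta) (A : Delta -> 'M[R]_p).

Lemma cocycle_iterD n m x : cocycle_iter T A (n + m) x =
  cocycle_iter T A m (iter n T x) *m cocycle_iter T A n x.
Proof.
elim: m => [|m IH]; first by rewrite addn0 mul1mx.
by rewrite addnS /= IH mulmxA -iterD addnC.
Qed.

(** [slow] bounds squared norms by [C * expR (eta * n)]. For large [n] the constant is absorbed by a
    second factor [expR (eta * n)], so the norm itself is at most [expR (eta * n)]. *)
Lemma central_stable_slow x v :
  (forall eta, 0 < eta -> slow (cocycle_iter T A ^~ x) eta v) -> central_stable T A x v.
Proof.
move=> hv; apply/lee_addgt0Pr => e e0; rewrite -EFinD.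
have eta0 : 0 < ln (1 + e) by rewrite ln_gt0// ltrDl.
have [C hC] := hv _ eta0; set eta := ln (1 + e) in eta0 hC.
have [N hN] := @archimedean_absorb R (ln (Num.max C 1)) eta eta0.
apply: (@le_trans _ _ (ereal_sup [set
   ((enorm (cocycle_iter T A n x *m v)) `^ (n%:R^-1))%:E | n in [set n | (N.+1 <= n)%N]])).
  apply: ereal_inf_lbound; exists [set n | (N.+1 <= n)%N] => //.
  by exists N.+1.
apply: ge_ereal_sup => _ [n /= nN <-]; rewrite lee_fin.
have n0 : 0 < n%:R :> R by rewrite ltr0n (leq_trans _ nN).
have C1 : Num.max C 1 <= expR (eta * n%:R).
  rewrite -[leLHS]lnK ?posrE ?lt_max ?ltr01 ?orbT// ler_expR hN//.
  exact: ltnW.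
have h : enorm (cocycle_iter T A n x *m v) <= expR (eta * n%:R).
  rewrite -[leRHS]gtr0_norm ?expR_gt0// -sqrtr_sqr ler_wsqrtr//.
  apply: (le_trans (hC n)); rewrite expr2 ler_wpM2r ?expR_ge0//.
  by apply: le_trans C1; rewrite le_max lexx.
have -> : 1 + e = (expR (eta * n%:R)) `^ (n%:R^-1).
  rewrite /powR gt_eqF ?expR_gt0// expRK mulrCA mulVf ?gt_eqF// mulr1 lnK//.
  by rewrite posrE addr_gt0.
by apply: ge0_ler_powR; rewrite ?nnegrE ?invr_ge0 ?sqrtr_ge0 ?expR_ge0// ltW.
Qed.

Lemma ler_entry_opnorm (M : 'M[R]_p) i j : `|M i j| <= opnorm M.
Proof.
have hub : has_ubound [set enorm (M *m w) | w in [set w : 'cV[R]_p | enorm w <= 1]].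
  exists (absum M) => _ [w /= w1 <-].
  rewrite -[leRHS]ger0_norm ?absum_ge0// -sqrtr_sqr ler_wsqrtr//.
  apply: (le_trans (sqn_mul_le _ _)); rewrite -[leRHS]mulr1 ler_wpM2l ?sqr_ge0//.
  by rewrite -(sqr_sqrtr (sqn_ge0 w)) expr_le1// sqrtr_ge0.
pose e : 'cV[R]_p := delta_mx j 0.
have e1 : enorm e = 1.
  rewrite /enorm (bigD1 j)//= big1 => [|k kj]; last by rewrite mxE (negPf kj) expr0n.
  by rewrite mxE !eqxx expr1n addr0 sqrtr1.
apply: (@le_trans _ _ (enorm (M *m e))); last first.
  by apply: (ub_le_sup hub); exists e => //=; rewrite e1.
rewrite -sqrtr_sqr ler_wsqrtr//.
have -> : M i j = (M *m e) i 0 by rewrite -colE mxE.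
exact: sqr_entry_le.
Qed.

Lemma absum_le_opnorm (M : 'M[R]_p) : absum M <= (p * p)%:R * opnorm M.
Proof.
apply: (@le_trans _ _ (\sum_(i < p) \sum_(j < p) opnorm M)).
  by apply: ler_sum => i _; apply: ler_sum => j _; exact: ler_entry_opnorm.
by rewrite !sumr_const !card_ord -mulrnA mulr_natl.
Qed.

(** The integral of a nonnegative function is a supremum over simple functions below it, hence
    monotone as it stands. This allows comparison with the integrand built from [opnorm] without
    proving it measurable. *)
Lemma le_integral_nonmeasurable (f g : Delta -> \bar R) :
  (forall x, (0 <= f x)%E) -> (forall x, (f x <= g x)%E) ->
  (\int[mu]_x f x <= \int[mu]_x g x)%E.
Proof.
move=> f0 fg; have g0 x : (0 <= g x)%E by exact: le_trans (f0 x) (fg x).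
rewrite !ge0_integralTE//; apply: le_ereal_sup => _ [h /= hf <-].
by exists h => //= x; exact: le_trans (hf x) (fg x).
Qed.

Hypothesis TA : measurable_cocycle mu T A.

Let Tmp : measure_preserving mu T. Proof. by case: TA. Qed.
Let Terg : ergodic mu T. Proof. by case: TA. Qed.
Let Aunit x : A x \in unitmx. Proof. by case: TA. Qed.
Let mA i j : measurable_fun setT (fun x => A x i j). Proof. by case: TA. Qed.

Definition logsum x := ln (1 + absum (A x)).

Lemma logsum_ge0 x : 0 <= logsum x.
Proof. by rewrite ln_ge0// lerDl absum_ge0. Qed.

Lemma measurable_absum : measurable_fun setT (fun x => absum (A x)).
Proof.
apply: measurable_sum => i; apply: measurable_sum => j.
exact: measurableT_comp.
Qed.

Lemma measurable_logsum : measurable_fun setT logsum.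
Proof.
apply: (measurableT_comp (@measurable_ln R)).
by apply: measurable_funD => //; exact: measurable_absum.
Qed.

Lemma integrable_logsum : (\int[mu]_x (logsum x)%:E < +oo)%E.
Proof.
have [_ _ _ _ iA] := TA.
(* [1 + absum] is at most [1 + (p * p)%:R] times the maximum of 1 and [opnorm], so past [k] the
   logarithm is below the integrand of the hypothesis. *)
pose k : R := ln (1 + (p * p)%:R).
pose g x := Num.max (logsum x - k) 0.
have g0 x : 0 <= g x by rewrite le_max lexx orbT.
have mg : measurable_fun setT g.
  by apply: measurable_maxr => //; apply: measurable_funB => //; exact: measurable_logsum.
have k0 : 0 <= k by rewrite ln_ge0// lerDl.
have ig : (\int[mu]_x (g x)%:E < +oo)%E.
  apply: le_lt_trans iA; apply: le_integral_nonmeasurable => x; first by rewrite lee_fin.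
  rewrite -EFin_max lee_fin /g ge_max [X in _ && X]le_max lexx orbT andbT le_max.
  have ha := absum_le_opnorm (A x); have a0 := absum_ge0 (A x).
  have q0 : 0 <= (p * p)%:R :> R by [].
  rewrite !subr_le0 lerBlDl; have [n1|n1] := leP (opnorm (A x)) 1; apply/orP.
    by right; rewrite ler_ln ?posrE; nra.
  left; rewrite -lnM ?posrE; [|nra|nra].
  by rewrite ler_ln ?posrE; nra.
apply: (@le_lt_trans _ _ (\int[mu]_x (cst k x)%:E + \int[mu]_x (g x)%:E)%E); last first.
  by rewrite integral_cst_probability lte_add_pinfty// ltry.
rewrite -ge0_integralD//.
- apply: ge0_le_integral => //.
  + by move=> x _; rewrite lee_fin logsum_ge0.
  + exact/measurable_EFinP/measurable_logsum.
  + by apply: emeasurable_funD; [exact/measurable_EFinP|exact/measurable_EFinP].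
  + move=> x _; rewrite -EFinD lee_fin -lerBlDl le_max lexx//.
- exact/measurable_EFinP.
- by move=> x _; rewrite lee_fin.
- exact/measurable_EFinP.
Qed.

Lemma measurable_cocycle_iter n i j :
  measurable_fun setT (fun x => cocycle_iter T A n x i j).
Proof.
elim: n i j => [|n IH] i j /=; first exact: measurable_cst.
apply: measurable_mulmx => // k l.
exact: (measurableT_comp (mA k l) (measurable_iter Tmp n)).
Qed.

Lemma cocycle_iter_unit n x : cocycle_iter T A n x \in unitmx.
Proof. by elim: n => [|n IH] /=; rewrite ?unitmx1// unitmx_mul IH Aunit. Qed.

(* The truncation at 1 keeps the process nonnegative, hence integrable, even
   when ln (vol2 q _) is not bounded below by an integrable function. *)
Definition vproc q n x := ln (Num.max 1 (vol2 q (cocycle_iter T A n x))).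

Lemma expR_vproc q n x : expR (vproc q n x) = Num.max 1 (vol2 q (cocycle_iter T A n x)).
Proof. by rewrite lnK// posrE lt_max ltr01. Qed.

Lemma vproc_ge0 q n x : 0 <= vproc q n x.
Proof. by rewrite ln_ge0// le_max lexx. Qed.

Lemma vproc0 q x : vproc q 0 x = 0.
Proof. by rewrite /vproc/= max_l ?ln1// vol2_id. Qed.

Lemma vprocD q n m x : vproc q (n + m) x <= vproc q n x + vproc q m (iter n T x).
Proof.
rewrite -ler_expR expRD !expR_vproc cocycle_iterD ge_max; apply/andP; split.
  by rewrite -[leLHS]mulr1 ler_pM// le_max lexx.
rewrite (le_trans (vol2M _ _ _))// mulrC ler_pM ?vol2_ge0// le_max lexx orbT//.
Qed.

Lemma measurable_vproc q n : measurable_fun setT (vproc q n).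
Proof.
apply: (measurableT_comp (@measurable_ln R)); apply: measurable_maxr => //.
apply: measurable_vol2; exact: measurable_cocycle_iter.
Qed.

Lemma integrable_vproc q : (\int[mu]_x (vproc q 1 x)%:E < +oo)%E.
Proof.
pose k : R := (2 * q)%:R.
have h x : vproc q 1 x <= k * logsum x.
  rewrite /k mulr_natl -lnXn ?posrE ?ltr_pwDl ?absum_ge0//.
  have a0 := absum_ge0 (A x).
  rewrite ler_ln ?posrE ?lt_max ?ltr01//; last by rewrite exprn_gt0// ltr_pwDl.
  rewrite ge_max /= mulmx1; apply/andP; split; first by rewrite exprn_ege1// lerDl.
  rewrite (le_trans (vol2_le_absum _ _))// -exprM.
  by rewrite lerXn2r ?nnegrE ?addr_ge0// lerDr.
apply: (@le_lt_trans _ _ (\int[mu]_x (k%:E * (logsum x)%:E))%E).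
  apply: ge0_le_integral => //.
  - by move=> x _; rewrite lee_fin vproc_ge0.
  - exact/measurable_EFinP/measurable_vproc.
  - apply/measurable_EFinP; apply: measurable_funM => //; exact: measurable_logsum.
  - by move=> x _; rewrite -EFinM lee_fin.
rewrite ge0_integralZl_EFin//.
- rewrite lte_mul_pinfty// ?lee_fin//; exact: integrable_logsum.
- by move=> x _; rewrite lee_fin logsum_ge0.
- exact/measurable_EFinP/measurable_logsum.
Qed.

Lemma upper_rate_mono q c c' : c <= c' ->
  upper_rate mu (vproc q) c -> upper_rate mu (vproc q) c'.
Proof.
move=> cc'; apply: filterS => x [N hN]; exists N => n /hN/le_trans; apply.
by rewrite ler_wpM2r.
Qed.

(** As [vol2] is a squared volume factor, this is twice the corresponding rate for volumes. *)
Definition rate q := inf [set c | 0 <= c /\ upper_rate mu (vproc q) c].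

Lemma rate_has_inf q : has_inf [set c | 0 <= c /\ upper_rate mu (vproc q) c].
Proof.
split; last by exists 0 => c [].
have if0 : (0 <= \int[mu]_x (vproc q 1 x)%:E)%E.
  by apply: integral_ge0 => x _; rewrite lee_fin vproc_ge0.
pose I := fine (\int[mu]_x (vproc q 1 x)%:E)%E.
have IE : I%:E = (\int[mu]_x (vproc q 1 x)%:E)%E.
  by rewrite fineK// ge0_fin_numE// integrable_vproc.
have I0 : 0 <= I by rewrite -lee_fin IE.
exists (I + 2); split; first lra.
apply: (@subadditive_upper _ _ _ _ _ Tmp Terg _ (measurable_vproc q) (vproc_ge0 q)
  (vproc0 q) (@vprocD q) (integrable_vproc q) 1 (I + 1)) => //; last lra.
by rewrite mulr1 -IE lte_fin; lra.
Qed.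

Lemma rate_ge0 q : 0 <= rate q.
Proof. by apply: lb_le_inf; [exact: (rate_has_inf q).1|move=> c []]. Qed.

Lemma upper_rate_gt q c : rate q < c -> upper_rate mu (vproc q) c.
Proof.
move=> rc; have e0 : 0 < c - rate q by rewrite subr_gt0.
have [c' [c0 hc'] c'c] := inf_adherent e0 (rate_has_inf q).
apply: upper_rate_mono hc'; apply: ltW.
by move: c'c; rewrite -/(rate q) addrC subrK.
Qed.

Lemma record_lt_rate q c : 0 <= c -> c < rate q ->
  {ae mu, forall x, exists i, limsup_set (record_set T (vproc q) c) (iter i T x)}.
Proof.
move=> c0 cr.
have := @upper_rate_or_record _ _ _ _ _ Tmp Terg _ (measurable_vproc q) (vproc_ge0 q)
  (vproc0 q) (@vprocD q) (integrable_vproc q) c ((c + rate q) / 2) c0.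
apply; first lra.
move=> h; have : rate q <= (c + rate q) / 2.
  by apply: ge_inf; [exact: (rate_has_inf q).2|split => //; lra].
lra.
Qed.

Lemma rate_eq0 q : (forall M : 'M[R]_p, vol2 q M <= 1) -> rate q = 0.
Proof.
move=> h; apply/eqP; rewrite eq_le rate_ge0 andbT.
apply: ge_inf; first exact: (rate_has_inf q).2.
split => //; apply: aeW => x; exists 0%N => n _.
by rewrite /vproc max_l// ln1 mul0r.
Qed.

(** Records of [iter i T x] are carried back to [x] at the cost of the inverse of the first [i]
    factors. For a fixed orbit this is a constant, so no integrability of the inverse is
    involved. *)
Lemma record_time_of_limsup q c x i : 0 < c ->
  limsup_set (record_set T (vproc q) c) (iter i T x) ->
  exists2 C, 0 < C & forall N0, exists2 N, (N0 <= N)%N &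
    record_time q (cocycle_iter T A ^~ x)
      (fun n N => cocycle_iter T A (N - n) (iter n T x)) c C i N.
Proof.
move=> c0 hlim; set y := iter i T x in hlim.
pose V := vol2 q (invmx (cocycle_iter T A i x)).
have V0 : 0 <= V by exact: vol2_ge0.
exists ((V + 1) * expR (c * i%:R)); first by rewrite mulr_gt0 ?expR_gt0//; lra.
move=> N0; have [m mN0 hm] := hlim N0.+1.
have m0 : (0 < m)%N by exact: leq_ltn_trans mN0.
exists (i + m)%N; first by rewrite (leq_trans _ (leq_addl _ _))// ltnW.
set VN := vol2 q (cocycle_iter T A (i + m) x).
have VN0 : 0 <= VN by exact: vol2_ge0.
have hVm : vol2 q (cocycle_iter T A m y) <= VN * (V + 1).
  have -> : cocycle_iter T A m y =
      cocycle_iter T A (i + m) x *m invmx (cocycle_iter T A i x).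
    by rewrite cocycle_iterD mulmxK// cocycle_iter_unit.
  by rewrite (le_trans (vol2M _ _ _))// ler_wpM2l// -/V lerDl.
have hcm : c * m%:R <= vproc q m y.
  by have := hm m; rewrite m0 leqnn subnn vproc0 add0r; apply.
(* Positivity of [c] makes the process positive at a record, so the truncation at 1 is inactive
   there. *)
have Vm : expR (vproc q m y) = vol2 q (cocycle_iter T A m y).
  rewrite expR_vproc max_r// leNgt; apply/negP => h.
  have v0 : vproc q m y = 0 by rewrite /vproc max_l ?ln1// ltW.
  by move: hcm; rewrite v0 leNgt mulr_gt0// ltr0n.
have hj j : (j <= m)%N ->
    vol2 q (cocycle_iter T A (m - j) (iter j T y)) * expR (c * j%:R) <= VN * (V + 1).
  move=> jm; apply: le_trans hVm; rewrite -Vm.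
  have [->|j0] := posnP j; first by rewrite subn0 mulr0 expR0 mulr1 -[iter 0 T y]/y Vm.
  have := hm j; rewrite j0 jm => /(_ isT) h.
  apply: (@le_trans _ _ (expR (vproc q (m - j) (iter j T y)) * expR (c * j%:R))).
    by rewrite ler_wpM2r ?expR_ge0// expR_vproc le_max lexx orbT.
  by rewrite -expRD ler_expR.
have ei n : (i <= n)%N -> expR (c * n%:R) = expR (c * (n - i)%:R) * expR (c * i%:R).
  by move=> ni; rewrite -expRD -mulrDr -natrD subnK.
split.
- have : 0 < vol2 q (cocycle_iter T A m y) by rewrite -Vm expR_gt0.
  move=> h; have := lt_le_trans h hVm; rewrite pmulr_lgt0//; lra.
- rewrite (ei (i + m)%N) ?leq_addr// addKn mulrAC ler_wpM2r ?expR_ge0// [leRHS]mulrC.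
  by apply: le_trans hVm; rewrite -Vm ler_expR.
- move=> n /andP[ni nN]; rewrite (ei n)// mulrA [leRHS]mulrAC ler_wpM2r ?expR_ge0//.
  have := hj (n - i)%N; rewrite leq_subLR nN => /(_ isT).
  by rewrite /y -iterD subnK// subnBA// addnC [leRHS]mulrC.
Qed.

Definition expanding x (G0 : {vspace 'cV[R]_p}) :=
  exists2 chi, 0 < chi & forall N0, exists2 N, (N0 <= N)%N &
    forall g, g \in G0 -> expR (chi * N%:R) * sqn g <= sqn (cocycle_iter T A N x *m g).

Theorem ae_expanding : {ae mu, forall x (G0 : {vspace 'cV[R]_p}),
  (forall v, v \in G0 -> central_stable T A x v -> v = 0) -> expanding x G0}.
Proof.
have exq : exists q, rate q.+1 <= rate q.
  by exists p; rewrite (@rate_eq0 p.+1) ?rate_ge0// => M; rewrite vol2_dim_gt.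
(* If the minimal index is 0, every vector grows subexponentially, so transversality forces [G0] to
   be zero and expansion is trivial. *)
case: (ex_minnP exq) => -[|q] hq minq.
  have r1 : rate 1 = 0.
    apply/eqP; rewrite eq_le rate_ge0 andbT (le_trans hq)// rate_eq0//.
    exact: vol2_dim0.
  have : {ae mu, forall x (k : nat), exists N, forall n, (N <= n)%N ->
      vproc 1 n x <= k.+1%:R^-1 * n%:R}.
    by apply: ae_foralln => k; apply: upper_rate_gt; rewrite r1 invr_gt0 ltr0n.
  apply: filterS => x hx G0 hG; exists 1 => // N0; exists N0 => // g gG.
  suff -> : g = 0 by rewrite mulmx0 sqn0 mulr0.
  apply: hG => //; apply: central_stable_slow => eta eta0.
  have [k hk] := @archimedean_absorb R 1 eta eta0.
  have ke : k.+1%:R^-1 <= eta.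
    by rewrite -div1r ler_pdivrMr ?ltr0n// hk.
  have [N hN] := hx k.
  exists (sqn g + \sum_(n < N) sqn (cocycle_iter T A n x *m g)) => n.
  have E1 : 1 <= expR (eta * n%:R) by rewrite -expR0 ler_expR mulr_ge0// ltW.
  have S0 : 0 <= \sum_(n < N) sqn (cocycle_iter T A n x *m g).
    by apply: sumr_ge0 => *; exact: sqn_ge0.
  have g0 := sqn_ge0 g.
  have [nN|nN] := leqP N n.
    have h : vol2 1 (cocycle_iter T A n x) <= expR (eta * n%:R).
      apply: (@le_trans _ _ (expR (vproc 1 n x))).
        by rewrite expR_vproc le_max lexx orbT.
      by rewrite ler_expR (le_trans (hN n nN))// ler_wpM2r.
    apply: (le_trans (sqn_le_vol2 _ _)).
    by have := ler_wpM2r g0 h; nra.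
  have h : sqn (cocycle_iter T A n x *m g) <= \sum_(n < N) sqn (cocycle_iter T A n x *m g).
    by rewrite (bigD1 (Ordinal nN))//= lerDl; apply: sumr_ge0 => *; exact: sqn_ge0.
  nra.
have gap : rate q < rate q.+1.
  by rewrite ltNge; apply/negP => /minq; rewrite ltnn.
pose kap := rate q.+1 - rate q.
have kap0 : 0 < kap by rewrite subr_gt0.
have r0 := rate_ge0 q.
(* A countable family of tolerances tending to 0 keeps the exceptional null set independent of [G0].
   The bound by [kap / 8] leaves room in the gap for two losses of [kap / 4]. *)
pose eps (k : nat) := kap / 8 * k.+1%:R^-1.
have eps0 k : 0 < eps k by rewrite mulr_gt0 ?invr_gt0 ?ltr0n//; lra.
have eps1 k : eps k <= kap / 8.
  by rewrite /eps ger_pMr ?invf_le1 ?ltr0n ?ler1n//; lra.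
have H1 : {ae mu, forall x k, exists N, forall n, (N <= n)%N ->
    vproc q.+2 n x <= (rate q.+1 + eps k) * n%:R}.
  by apply: ae_foralln => k; apply: upper_rate_gt; have := eps0 k; lra.
have H2 : {ae mu, forall x, exists N, forall n, (N <= n)%N ->
    vproc q n x <= (rate q + kap / 4) * n%:R}.
  by apply: upper_rate_gt; lra.
have H3 : {ae mu, forall x k, exists i,
    limsup_set (record_set T (vproc q.+1) (rate q.+1 - eps k)) (iter i T x)}.
  apply: ae_foralln => k; apply: record_lt_rate; have := eps0 k; have := eps1 k.
    by rewrite /kap; lra.
  lra.
apply: filterS3 H1 H2 H3 => x h1 h2 h3 G0 hG.
pose M := cocycle_iter T A ^~ x.
(* One tolerance suffices for the given [G0]: vectors slow at every tolerance are central stable,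
   and the decreasing spaces of slow vectors become trivial in [G0] at a finite stage. *)
have [m hm] : exists m, forall v, v \in G0 -> slow M (2 * eps m) v -> v = 0.
  apply: (@decreasing_subspaces _ _ (fun m v => slow M (2 * eps m) v)).
  - move=> m n v mn; apply: slow_mono; rewrite ler_wpM2l// ler_wpM2l//; first lra.
    by rewrite lef_pV2 ?posrE ?ltr0n// ler_nat ltnS.
  - by move=> m a u v; exact: slow_comb.
  - move=> v vG hv; apply: hG => //; apply: central_stable_slow => eta eta0.
    have [k hk] := @archimedean_absorb R kap eta eta0.
    apply: slow_mono (hv k).
    rewrite /eps mulrA ler_pdivrMr ?ltr0n//; have := hk k.+1 (leqnSn k); lra.
exists (kap / 4); first lra.
have [i hi] := h3 m.
have ck : 0 < rate q.+1 - eps m by have := eps1 m; rewrite /kap; lra.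
have [C C0 hC] := record_time_of_limsup ck hi.
have [N1 hN1] := h1 m; have [N2 hN2] := h2.
have tovol q' n c : vproc q' n x <= c * n%:R -> vol2 q' (M n) <= expR (c * n%:R).
  move=> h; apply: (@le_trans _ _ (expR (vproc q' n x))); last by rewrite ler_expR.
  by rewrite expR_vproc le_max lexx orbT.
apply: (@uniform_growth _ _ q M (fun n N => cocycle_iter T A (N - n) (iter n T x))
  G0 (rate q.+1) (rate q + kap / 4) (eps m) (kap / 4) C i (maxn N1 N2)) => //.
- exact: ltW.
- by move=> n N nN; rewrite /M -cocycle_iterD subnKC.
- by move=> n; rewrite geq_max => /andP[n1 _]; apply: tovol; exact: hN1.
- by move=> n; rewrite geq_max => /andP[_ n2]; apply: tovol; exact: hN2.
- by have := eps1 m; rewrite /kap; lra.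
Qed.

End Cocycle.

(** * Coverings by small sets *)

Section Hausdorff.
Set Implicit Arguments.
Unset Strict Implicit.
Variables (R : realType) (p : nat).
Implicit Types S U : set 'cV[R]_p.

Lemma diam_pow_ge0 s U : (0 <= diam_pow s U)%E.
Proof. by rewrite /diam_pow; case: ifP => // _; rewrite lee_fin powR_ge0. Qed.

Lemma diam_pow_set0 s : diam_pow s (set0 : set 'cV[R]_p) = 0%E.
Proof. by rewrite /diam_pow eqxx. Qed.

Lemma ediam_set0 : ediam (set0 : set 'cV[R]_p) = -oo%E.
Proof.
rewrite /ediam (_ : image2 _ _ _ = set0) ?ereal_sup0//.
by apply/seteqP; split => // x [? []].
Qed.

Definition null_cover s delta tau S := exists U : nat -> set 'cV[R]_p,
  [/\ S `<=` \bigcup_j U j, (forall j, (ediam (U j) <= delta%:E)%E) &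
      (\sum_(0 <= j <oo) diam_pow s (U j) <= tau%:E)%E].

Lemma hausdorff_measure_eq0 s S :
  (forall delta tau, 0 < delta -> 0 < tau -> null_cover s delta tau S) ->
  hausdorff_measure s S = 0%E.
Proof.
move=> h; have hc delta : 0 < delta -> hausdorff_content s delta S = 0%E.
  move=> d0; apply/eqP; rewrite eq_le; apply/andP; split.
    apply/lee_addgt0Pr => tau tau0; rewrite add0e.
    have [U [SU dU sU]] := h _ _ d0 tau0; apply: le_trans sU.
    by apply: ereal_inf_lbound; exists U.
  apply: le_ereal_inf_tmp => _ [U _ <-]; apply: nneseries_ge0 => j _ _.
  exact: diam_pow_ge0.
rewrite /hausdorff_measure (_ : [set _ | _ in _] = [set 0%E]) ?ereal_sup1//.
apply/seteqP; split => [_ [delta d0 <-]|_ ->]; first exact: hc.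
by exists 1 => /=; rewrite ?hc// ltr01.
Qed.

(** The n-th piece receives the budget [tau / 2 ^ n.+1]; the resulting double sequence of sets is
    listed through a bijection of the naturals with pairs. *)
Lemma null_cover_bigcup (I : countType) s delta tau S (F : I -> set 'cV[R]_p) :
  0 < tau -> S `<=` \bigcup_i F i ->
  (forall i tau', 0 < tau' -> null_cover s delta tau' (F i)) ->
  null_cover s delta tau S.
Proof.
move=> tau0 SF hF.
pose F' (n : nat) := if unpickle n is Some i then F i else set0.
have hF' n : null_cover s delta (tau / (2 ^ n.+1)%:R) (F' n).
  have t0 : 0 < tau / (2 ^ n.+1)%:R by rewrite divr_gt0// ltr0n expn_gt0.
  rewrite /F'; case: (unpickle n) => [i|]; first exact: hF.
  exists (fun=> set0); split => //; first by move=> j; rewrite ediam_set0 leNye.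
  by rewrite eseries0 ?lee_fin ?ltW// => k _ _; rewrite diam_pow_set0.
have [G PG] := choice hF'.
have /card_esym/ppcard_eqP[f] := card_nat2.
exists (uncurry G \o f); split.
- move=> x /SF[i _ Fx].
  have : F' (pickle i) x by rewrite /F' pickleK.
  have [GF _ _] := PG (pickle i).
  move=> /GF[j _ Gx]; exists (f^-1%FUN (pickle i, j)) => //=.
  by rewrite invK ?inE.
- by move=> k /=; case: (f k) => a b /=; have [_ + _] := PG a; apply.
have g0 x : (0 <= (diam_pow s \o uncurry G) x)%E by exact: diam_pow_ge0.
apply: (@le_trans _ _ (\esum_(i in setT) (diam_pow s \o uncurry G) i)).
  rewrite -(esum_pred_image (diam_pow s \o uncurry G) _ xpredT) ?[fun=> _]set_true//.
  by rewrite image_eq.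
(* The unordered sum over pairs is split along rows to bring in the bound for each piece. *)
rewrite (_ : esum _ _ = \sum_(i <oo) \sum_(j <oo) diam_pow s (G i j))%E; last first.
  pose J : nat -> set (nat * nat) := fun i => [set (i, j) | j in setT].
  rewrite (_ : setT = \bigcup_k J k); last first.
    by rewrite predeqE => -[a b]; split => // _; exists a => //; exists b.
  rewrite esum_bigcupT /=; last 2 first.
    - apply/trivIsetP => i j _ _ ij.
      rewrite predeqE => -[n m] /=; split => //= -[] [_] _ [<-{n} _].
      by move=> [m' _] [] /esym/eqP; rewrite (negbTE ij).
    - exact: g0.
  rewrite -(image_id [set: nat]) -fun_true esum_pred_image//; last first.
    by move=> n _; apply: esum_ge0 => x _; exact: g0.
  apply: eq_eseriesr => /= j _.
  rewrite -(esum_pred_image (diam_pow s \o uncurry G) (pair j) predT)/=; last 2 first.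
    - by move=> n _; exact: diam_pow_ge0.
    - by move=> ? ? _ _; exact: (@can_inj _ _ _ snd).
  by congr esum; rewrite predeqE => -[a b]; split; move=> [i _ <-]; exists i.
apply: (@le_trans _ _ (\sum_(i <oo) (tau / (2 ^ i.+1)%:R)%:E)%E).
  apply: lee_nneseries => // i _; first by move=> _; apply: nneseries_ge0 => *; exact: diam_pow_ge0.
  by have [_ _ +] := PG i.
exact: epsilon_trick0 (ltW tau0).
Qed.

Lemma hausdorff_dim_eq0 S : (forall s, 0 < s -> hausdorff_measure s S = 0%E) ->
  hausdorff_dim S = 0%E.
Proof.
move=> h; apply/eqP; rewrite eq_le; apply/andP; split.
  apply/lee_addgt0Pr => e e0; rewrite add0e.
  by apply: ereal_inf_lbound; exists e => //=; split; [exact: ltW|exact: h].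
by apply: le_ereal_inf_tmp => _ [s [s0 _] <-]; rewrite lee_fin.
Qed.

Lemma ediam_le U (b : R) : (forall u v, U u -> U v -> enorm (u - v) <= b) ->
  (ediam U <= b%:E)%E.
Proof. by move=> h; apply: ge_ereal_sup => _ [u Uu [v Uv <-]]; rewrite lee_fin h. Qed.

Lemma diam_pow_le s U (b : R) : 0 < s -> 0 <= b ->
  (forall u v, U u -> U v -> enorm (u - v) <= b) -> (diam_pow s U <= (b `^ s)%:E)%E.
Proof.
move=> s0 b0 h; rewrite /diam_pow; case: ifPn => [_|/set0P[u Uu]].
  by rewrite lee_fin powR_ge0.
(* A nonempty set has nonnegative diameter; with the upper bound it is finite, so [fine] returns the
   true value. *)
have d0 : (0 <= ediam U)%E.
  apply: ereal_sup_ubound; exists u => //; exists u => //.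
  by rewrite subrr /enorm big1 ?sqrtr0// => i _; rewrite mxE expr0n.
have db := ediam_le h.
have dfin : ediam U \is a fin_num by rewrite ge0_fin_numE// (le_lt_trans db)// ltry.
rewrite lee_fin; apply: ge0_ler_powR; rewrite ?nnegrE ?fine_ge0 ?(ltW s0)//.
by rewrite -lee_fin fineK.
Qed.

(** A finite cover is padded with empty sets, which contribute 0 to the sum and have diameter
    [-oo]. *)
Lemma null_cover_finite s delta tau S (n : nat) (U : nat -> set 'cV[R]_p) (b : R) :
  0 < s -> 0 <= b -> b <= delta -> S `<=` \bigcup_(j in [set j | (j < n)%N]) U j ->
  (forall j u v, (j < n)%N -> U j u -> U j v -> enorm (u - v) <= b) ->
  n%:R * b `^ s <= tau -> null_cover s delta tau S.
Proof.
move=> s0 b0 bd SU hU hn.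
exists (fun j => if (j < n)%N then U j else set0); split.
- by move=> x /SU[j /= jn Ux]; exists j => //; rewrite jn.
- move=> j; case: ifP => [jn|_]; last by rewrite ediam_set0 leNye.
  apply: (@le_trans _ _ b%:E); last by rewrite lee_fin.
  by apply: ediam_le => u v; exact: hU.
apply: lime_le.
  by apply: is_cvg_nneseries => j _ _; exact: diam_pow_ge0.
apply: nearW => m.
apply: (@le_trans _ _ ((minn m n)%:R * b `^ s)%:E); last first.
  rewrite lee_fin (le_trans _ hn)// ler_wpM2r ?powR_ge0// ler_nat; exact: geq_minr.
elim: m => [|m IH]; first by rewrite big_geq// min0n mul0r.
rewrite big_nat_recr//=; have [mn|mn] := ltnP m n.
  rewrite (minn_idPl mn) -natr1 mulrDl mul1r EFinD; apply: leeD.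
    by rewrite (minn_idPl (ltnW mn)) in IH.
  by apply: diam_pow_le => // u v; exact: hU.
rewrite diam_pow_set0 adde0 (minn_idPr (leqW mn)).
by rewrite (minn_idPr mn) in IH.
Qed.

End Hausdorff.

(** * Integer points in a cube *)

Section IntegerPoints.
Set Implicit Arguments.
Unset Strict Implicit.
Variables (R : realType) (p : nat).

(** In each coordinate the list starts at the least integer above [c - r]. It may exceed the open
    cube; only covering the cube and the size bound matter. *)
Definition near_ints (c : 'cV[R]_p) (r : R) : seq 'cV[int]_p :=
  [seq \col_i (Num.floor (c i 0 - r) + 1 + ((f : {ffun 'I_p -> 'I_(Num.truncn (2 * r)).+1}) i)%:Z)
  | f : {ffun 'I_p -> 'I_(Num.truncn (2 * r)).+1}].

(** Each coordinate has one candidate if [2 * r < 1], and at most [2 * r + 1 <= 4 * r] otherwise.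
    Having exactly one for small [r] is what lets the branching vanish at fine scales. *)
Lemma size_near_ints c r : 0 <= r ->
  (size (near_ints c r))%:R <= (Num.max 1 (4 * r)) ^+ p :> R.
Proof.
move=> r0; rewrite size_map -cardE card_ffun !card_ord natrX lerXn2r ?nnegrE//.
  by rewrite le_max ler01.
have r20 : 0 <= 2 * r by rewrite mulr_ge0.
have /andP[h _] := truncn_itv r20.
rewrite le_max; have [r1|r1] := ltP (2 * r) 1.
  have -> : Num.truncn (2 * r) = 0%N.
    by apply/eqP; rewrite -leqn0 -ltnS -(ltr_nat R); apply: le_lt_trans r1.
  by rewrite lexx.
by apply/orP; right; rewrite -natr1; lra.
Qed.

Lemma mem_near_ints (c : 'cV[R]_p) (r : R) (z : 'cV[int]_p) :
  (forall i, `|c i 0 - (z i 0)%:~R| < r) -> z \in near_ints c r.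
Proof.
move=> h; pose k i := z i 0 - (Num.floor (c i 0 - r) + 1).
have k0 i : 0 <= k i.
  rewrite subr_ge0 lezD1 -(ltr_int R).
  apply: (le_lt_trans (floor_le _)); have := h i; rewrite ltr_norml; lra.
have k1 i : (`|k i| < (Num.truncn (2 * r)).+1)%N.
  rewrite -(ltr_nat R); apply: lt_trans (truncnS_gt _).
  have -> : `|k i|%:R = (k i)%:~R :> R by rewrite -[in RHS](gez0_abs (k0 i)).
  rewrite /k intrB; have := h i; have := floorD1_gt (c i 0 - r).
  rewrite ltr_norml; lra.
apply/mapP; exists [ffun i => Ordinal (k1 i)]; first by rewrite mem_enum.
apply/matrixP => i j; rewrite ord1 !mxE ffunE /= gez0_abs// /k addrC subrK.
by [].
Qed.

End IntegerPoints.

(** * Counting integer itineraries *)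

Section Counting.
Set Implicit Arguments.
Unset Strict Implicit.
Context (d : measure_display) (R : realType) (Delta : measurableType d).
Variables (mu : probability Delta R) (p : nat).
Variables (T : Delta -> Delta) (A : Delta -> 'M[R]_p).

(* At scale delta = (4 * m.+1)^-1, [expR (branching m x)] bounds the number of
   integer vectors within (1 + absum (A x)) * delta of a given vector. *)
Definition branching m x : R := p%:R * ln (Num.max 1 ((1 + absum (A x)) / m.+1%:R)).

Lemma branching_ge0 m x : 0 <= branching m x.
Proof. by rewrite mulr_ge0// ln_ge0// le_max lexx. Qed.

(** As [m] grows, [branching m] tends to 0 pointwise under an integrable bound, so its integral
    drops below any [j.+1%:R^-1] and the one-sided Birkhoff bound applies. *)
Lemma ae_branching : measurable_cocycle mu T A ->
  {ae mu, forall x (j : nat), exists m N, forall n, (N <= n)%N ->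
     \sum_(k < n) branching m (iter k T x) <= j.+1%:R^-1 * n%:R}.
Proof.
move=> TA; have [Tmp Terg _ _ _] := TA.
have mb m : measurable_fun setT (branching m).
  apply: measurable_funM => //; apply: (measurableT_comp (@measurable_ln R)).
  apply: measurable_maxr => //; apply: measurable_funM => //.
  by apply: measurable_funD => //; exact: (measurable_absum TA).
have mh : measurable_fun setT (fun x => p%:R * logsum A x).
  by apply: measurable_funM => //; exact: (measurable_logsum TA).
have bh m x : branching m x <= p%:R * logsum A x.
  have a0 := absum_ge0 (A x).
  rewrite ler_wpM2l// ler_ln ?posrE ?lt_max ?ltr01 ?ltr_pwDl//.
  by rewrite ge_max lerDl a0/= ler_pdivrMr ?ltr0n// ler_peMr ?ler1n// addr_ge0.
have ih : (\int[mu]_x (p%:R * logsum A x)%:E < +oo)%E.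
  under eq_integral do rewrite EFinM.
  rewrite ge0_integralZl_EFin//.
  - by rewrite lte_mul_pinfty// ?lee_fin//; exact: (integrable_logsum TA).
  - by move=> x _; rewrite lee_fin logsum_ge0.
  - exact/measurable_EFinP/(measurable_logsum TA).
have bcvg x : branching^~ x @ \oo --> 0.
  apply: cvg_near_cst.
  have [N hN] := @archimedean_absorb R (1 + absum (A x)) 1 ltr01.
  exists N => // m /= Nm; rewrite /branching max_l ?ln1 ?mulr0//.
  by rewrite ler_pdivrMr ?ltr0n// hN// leqW.
apply: ae_foralln => j.
have j0 : 0 < j.+1%:R^-1 :> R by rewrite invr_gt0 ltr0n.
have [m hm] := integral_small mb mh branching_ge0 bh ih bcvg j0.
apply: filterS (birkhoff_upper Tmp Terg (mb m) (branching_ge0 m) hm) => x [N hN].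
by exists m, N.
Qed.

Lemma expR_branching m x :
  expR (branching m x) = (Num.max 1 ((1 + absum (A x)) / m.+1%:R)) ^+ p.
Proof. by rewrite expRM_natl lnK// posrE lt_max ltr01. Qed.

Lemma size_flatten_le (I J : eqType) (s : seq I) (f : I -> seq J) (B : R) :
  (forall i, (size (f i))%:R <= B) ->
  (size (flatten [seq f i | i <- s]))%:R <= (size s)%:R * B.
Proof.
move=> h; elim: s => [|i s IH] /=; first by rewrite mul0r.
by rewrite size_cat natrD -natr1 mulrDl mul1r addrC lerD.
Qed.

Lemma enorm_sqn n (v : 'cV[R]_n) : enorm v ^+ 2 = sqn v.
Proof. by rewrite sqr_sqrtr// sqn_ge0. Qed.

Lemma entry_le_enorm n (v : 'cV[R]_n) i : `|v i 0| <= enorm v.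
Proof. by rewrite -sqrtr_sqr ler_wsqrtr// sqr_entry_le. Qed.

Lemma enorm_mul_le n (B : 'M[R]_n) (v : 'cV[R]_n) : enorm (B *m v) <= absum B * enorm v.
Proof.
rewrite -[X in X * _]ger0_norm ?absum_ge0// -sqrtr_sqr -sqrtrM ?sqr_ge0//.
by rewrite ler_wsqrtr// sqn_mul_le.
Qed.

(** Fixing the time [N0] and the first vector [z0] splits the weak-stable space into countably many
    pieces, each with a single initial itinerary. *)
Definition orbit_near_ints delta x N0 (z0 : 'cV[int]_p) : set 'cV[R]_p :=
  [set w | enorm (cocycle_iter T A N0 x *m w - int_vec R z0) < delta /\
     forall n, (N0 <= n)%N ->
       exists z, enorm (cocycle_iter T A n x *m w - int_vec R z) < delta].

Lemma itinerary_list m x N0 z0 n : (N0 <= n)%N ->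
  let delta := (4 * m.+1%:R)^-1 : R in
  exists2 L : seq 'cV[int]_p,
    (size L)%:R <= expR (\sum_(k < n) branching m (iter k T x)) &
    forall w, orbit_near_ints delta x N0 z0 w ->
      exists2 z, z \in L & enorm (cocycle_iter T A n x *m w - int_vec R z) < delta.
Proof.
move=> N0n delta; have d0 : 0 < delta by rewrite invr_gt0 mulr_gt0 ?ltr0n.
elim: n N0n => [|n IH].
  rewrite leqn0 => /eqP N00; exists [:: z0]; first by rewrite big_ord0 expR0.
  by move=> w [h _]; exists z0; rewrite ?mem_head//; rewrite N00 in h.
rewrite leq_eqVlt => /orP[/eqP N0E|].
  exists [:: z0].
    by rewrite /= -expR0 ler_expR sumr_ge0// => k _; exact: branching_ge0.
  by move=> w [h _]; exists z0; rewrite ?mem_head//; rewrite N0E in h.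
rewrite ltnS => N0n; have [L sL hL] := IH N0n.
(* If [z] is within [delta] of the orbit point, its image errs by at most [absum B * delta], and the
   next integer vector by less than [delta] more. *)
set B := A (iter n T x); pose r := (1 + absum B) * delta.
have r0 : 0 <= r by rewrite mulr_ge0 ?(ltW d0)// addr_ge0 ?absum_ge0.
exists (flatten [seq near_ints (B *m int_vec R z) r | z <- L]).
  rewrite big_ord_recr/= expRD expR_branching.
  have r4 : 4 * r = (1 + absum B) / m.+1%:R.
    by rewrite /r /delta; field; rewrite ?pnatr_eq0.
  apply: (le_trans (size_flatten_le L (B := Num.max 1 (4 * r) ^+ p) _)).
    by move=> z; exact: size_near_ints.
  rewrite r4 ler_wpM2r// exprn_ge0// le_max ler01//.
move=> w hw; have [z zL hz] := hL w hw.
have [z' hz'] := hw.2 n.+1 (leqW N0n).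
exists z' => //; apply/flattenP; exists (near_ints (B *m int_vec R z) r).
  by apply/mapP; exists z.
apply: mem_near_ints => i.
have -> : (B *m int_vec R z) i 0 - (z' i 0)%:~R =
   - (B *m (cocycle_iter T A n x *m w - int_vec R z)) i 0 +
   (cocycle_iter T A n.+1 x *m w - int_vec R z') i 0.
  by rewrite mulmxBr /= -mulmxA !mxE; ring.
apply: (le_lt_trans (ler_normD _ _)); rewrite normrN /r mulrDl mul1r addrC.
apply: ltr_leD; first exact: le_lt_trans (entry_le_enorm _ _) hz'.
apply: (le_trans (entry_le_enorm _ _)); apply: (le_trans (enorm_mul_le _ _)).
by rewrite ler_wpM2l ?absum_ge0// ltW.
Qed.

Lemma weak_stable_orbit_near delta x w : 0 < delta -> weak_stable T A x w ->
  exists N0 z0, orbit_near_ints delta x N0 z0 w.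
Proof.
move=> d0 /cvgrPdist_lt/(_ _ d0)[N _ hN].
have near n : (N <= n)%N ->
    exists z, enorm (cocycle_iter T A n x *m w - int_vec R z) < delta.
  move=> Nn; set v := cocycle_iter T A n x *m w.
  have hinf : has_inf [set enorm (v - int_vec R z) | z in [set: 'cV[int]_p]].
    split; first by exists (enorm (v - int_vec R 0)), 0.
    by exists 0 => _ [z _ <-]; exact: sqrtr_ge0.
  have := hN n Nn; rewrite /= sub0r normrN => h.
  have e0 : 0 < delta - torus_norm v.
    by rewrite subr_gt0; apply: le_lt_trans h; exact: ler_norm.
  have [_ [z _ <-]] := inf_adherent e0 hinf.
  by rewrite -/(torus_norm v) subrKC => hz; exists z.
have [z0 hz0] := near N (leqnn N).
by exists N, z0.
Qed.

End Counting.

(** * Covering the transverse slice *)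

Theorem theoremA1 (d : measure_display) (R : realType)
    (Delta : measurableType d) (mu : probability Delta R) (p : nat)
    (T : Delta -> Delta) (A : Delta -> 'M[R]_p) :
  measurable_cocycle mu T A ->
  {ae mu, forall x : Delta,
    forall (G0 : {vspace 'cV[R]_p}) (a : 'cV[R]_p),
      (forall v : 'cV[R]_p, v \in G0 -> central_stable T A x v -> v = 0) ->
      hausdorff_dim ([set a + v | v in [set v | v \in G0]] `&` weak_stable T A x)
        = 0%E}.
Proof.
move=> TA.
apply: filterS2 (ae_expanding TA) (ae_branching TA) => x hexp hbr G0 a hG.
have [chi chi0 hN] := hexp G0 hG.
apply: hausdorff_dim_eq0 => s s0; apply: hausdorff_measure_eq0 => delta tau d0 t0.
(* At most [expR (s * chi / 4 * N)] sets of diameter at most [expR (- (chi / 2) * N)] will be used;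
   the sum of s-th powers is then at most [expR (- (s * chi / 4) * N)]. The half in the diameter
   arises because [chi] governs squared norms. *)
have eta0 : 0 < s * chi / 4 by rewrite !mulr_gt0.
have [j hj] := @archimedean_absorb R 1 _ eta0.
have [m [N1 hN1]] := hbr j.
set dl := (4 * m.+1%:R)^-1 : R.
have dl0 : 0 < dl by rewrite invr_gt0 mulr_gt0 ?ltr0n.
have dl1 : dl <= 4^-1.
  by rewrite lef_pV2 ?posrE ?mulr_gt0 ?ltr0n// ler_peMr// ler1n.
set G := [set a + v | v in [set v | v \in G0]].
pose F (i : nat * 'cV[int]_p) := G `&` orbit_near_ints T A dl x i.1 i.2.
apply: (@null_cover_bigcup _ _ _ _ _ _ _ F) => //.
  move=> w [Gw ww]; have [N0 [z0 h]] := weak_stable_orbit_near dl0 ww.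
  by exists (N0, z0).
move=> [N0 z0] tau' t0'; rewrite /F/=.
have [N2 hN2] := @expR_decay R (- (chi / 2)) delta ltac:(lra) d0.
have [N3 hN3] := @expR_decay R (- (s * chi / 4)) tau' ltac:(lra) t0'.
(* A single expanding time beyond all thresholds suffices: [N2] makes the diameters at most [delta],
   and [N3] the total at most [tau']. *)
have [N NN hexpN] := hN (maxn (maxn N0 N1) (maxn N2 N3)).
move: NN; rewrite !geq_max => /andP[/andP[NN0 NN1] /andP[NN2 NN3]].
have [L sL hL] := itinerary_list T A m x z0 NN0; rewrite -/dl in hL.
pose U k := G `&` [set w | enorm (cocycle_iter T A N x *m w - int_vec R (nth 0 L k)) < dl].
pose b : R := expR (- (chi / 2) * N%:R).
apply: (@null_cover_finite _ _ s delta tau' _ (size L) U b) => //.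
- exact: expR_ge0.
- exact: hN2.
- move=> w [Gw /hL[z zL hz]]; exists (index z L); first by rewrite /= index_mem.
  by split=> //=; rewrite nth_index.
- move=> k u v _ [[u' u'G <-] hu] [[v' v'G <-] hv].
  (* Both points shadow the same integer vector at time [N], so their images differ by at most 1 in
     norm; their difference lies in [G0], where [A_N] expands. *)
  set u1 := a + u' in hu *; set v1 := a + v' in hv *.
  have uvG : u1 - v1 \in G0 by rewrite /u1 /v1 opprD addrACA subrr add0r memvB.
  have h := hexpN _ uvG.
  have hs : sqn (cocycle_iter T A N x *m (u1 - v1)) <= 1.
    set z := int_vec R (nth 0 L k) in hu hv.
    have -> : cocycle_iter T A N x *m (u1 - v1) =
      (cocycle_iter T A N x *m u1 - z) + - (cocycle_iter T A N x *m v1 - z).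
      by rewrite mulmxBr opprB addrA subrK.
    apply: (le_trans (sqnD_le _ _)); rewrite opprB (sqnB z) -!enorm_sqn.
    have quarter t : 0 <= t -> t < dl -> t ^+ 2 <= 4^-1 by move=> *; nra.
    have q1 : enorm (cocycle_iter T A N x *m u1 - z) ^+ 2 <= 4^-1.
      exact: quarter (sqrtr_ge0 _) hu.
    have q2 : enorm (cocycle_iter T A N x *m v1 - z) ^+ 2 <= 4^-1.
      exact: quarter (sqrtr_ge0 _) hv.
    lra.
  rewrite -[leRHS]ger0_norm ?expR_ge0// -sqrtr_sqr ler_wsqrtr//.
  rewrite -/(sqn _) /b -expRM_natl (_ : 2%:R * (- (chi / 2) * N%:R) = - (chi * N%:R)); last by field.
  rewrite expRN -div1r ler_pdivlMr ?expR_gt0// mulrC.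
  exact: le_trans h hs.
- apply: le_trans (hN3 N NN3).
  have -> : b `^ s = expR (- (s * chi / 2) * N%:R).
    by rewrite /powR gt_eqF ?expR_gt0// expRK; congr expR; field.
  have h1 : (size L)%:R <= expR (s * chi / 4 * N%:R).
    apply: (le_trans sL); rewrite ler_expR (le_trans (hN1 N NN1))// ler_wpM2r//.
    by rewrite -div1r ler_pdivrMr ?ltr0n// hj.
  apply: (le_trans (ler_wpM2r (expR_ge0 _) h1)).
  rewrite -expRD ler_expR le_eqVlt; apply/orP; left; apply/eqP; by field.
Qed.
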